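(* Fix $r\ge 4$ and $s\ge 1$. There is $n_0$ such that for all $n\ge n_0$ the following holds. If $H$ is an $n$-vertex $r$-graph with $\nu(H)\le s$ and $|H|>em(n,r,s-1)+hm''(n-s+1,r)$, then $V(H)$ contains a subset $Z=\{z_1,\ldots,z_{s-1}\}$ of $s-1$ vertices such that either $\tau(H-Z)=1$, or $H-Z\subseteq HM(n-s+1,r,t)$ for some $t\in\{1,\ldots,r-1,n-s+1-r\}$, or $r=4$ and $H-Z\subseteq HM(n-s+1,4,0)$. The bound on $|H|$ is sharp.
   Context: An $r$-graph is a family of $r$-element subsets (edges) of a finite vertex set. $\nu(H)$ is the maximum number of pairwise disjoint edges; $\tau(H)$ is the minimum size of a vertex set meeting every edge. $H-Z$ is the $r$-graph on $V(H)\setminus Z$ consisting of the edges of $H$ disjoint from $Z$. $em(n,r,s)=\binom{n}{r}-\binom{n-s}{r}$. ''$F\subseteq K$'' for a construction $K$ on $m$ vertices ($m=|V(F)|$) means the special vertices of $K$ can be chosen among $V(F)$ so every edge of $F$ is an edge of $K$. Constructions on an $m$-element vertex set: $HM(m,r,t)$, for $1\le t\le r-1$ or $t=m-r$: special distinct vertices $x,x_1,\ldots,x_{r-1},y_1,\ldots,y_t$; edges are all $r$-sets $e$ with (1) $\{x,x_i\}\subseteq e$ for some $i\in[r-1]$, or (2) $e=\{x_1,\ldots,x_{r-1},y_j\}$ for some $j\le t$, and (3) if $1\le t\le r-1$, also all $r$-sets containing $\{x,y_1,\ldots,y_t\}$. $HM(m,r,0)$: special vertices $x,x_1,x_2$;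 all $r$-sets containing at least two of them. $HM''(m,r)$: special distinct vertices $x,x_1,\ldots,x_{r-2},y_1,y_1',y_2,y_2'$; all $r$-sets $e$ such that $\{x,x_i\}\subseteq e$ for some $i\in[r-2]$, or $e$ contains one of $\{x,y_1,y_2\},\{x,y_1,y_2'\},\{x,y_1',y_2\},\{x,y_1',y_2'\}$, or $e=\{x_1,\ldots,x_{r-2},y_1,y_1'\}$ or $e=\{x_1,\ldots,x_{r-2},y_2,y_2'\}$. $hm''(m,r)=|HM''(m,r)|$. *)

(* Defs.v *)
From mathcomp Require Import all_boot.
Set Implicit Arguments.
Unset Strict Implicit.
Unset Printing Implicit Defensive.

Record runiform (T : finType) (r : nat) := RUniform {
  verts : {set T};
  edges :> {set {set T}};
  edgesP : {in edges, forall e : {set T}, e \subset verts /\ #|e| = r}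
}.

Definition nu (T : finType) (r : nat) (H : runiform T r) : nat :=
  \max_(M : {set {set T}} | (M \subset edges H) && trivIset M) #|M|.

Definition is_cover (T : finType) (r : nat) (H : runiform T r) (S : {set T}) :=
  (S \subset verts H) && [forall e in edges H, ~~ [disjoint e & S]].

(* The unit #|verts H| does not affect the minimum: for r >= 1 the whole
   vertex set is a cover. *)
Definition tau (T : finType) (r : nat) (H : runiform T r) : nat :=
  \big[minn/#|verts H|]_(S : {set T} | is_cover H S) #|S|.

Lemma del_subproof (T : finType) (r : nat) (H : runiform T r) (Z : {set T}) :
  {in [set e in edges H | [disjoint e & Z]],
    forall e : {set T}, e \subset verts H :\: Z /\ #|e| = r}.
Proof.
move=> e; rewrite inE => /andP[eH eZ].
by have [eV er] := edgesP eH; split=> //; rewrite subsetD eV.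
Qed.

(* H - Z *)
Definition del (T : finType) (r : nat) (H : runiform T r) (Z : {set T}) :
  runiform T r := RUniform (@del_subproof T r H Z).

Definition em (n r s : nat) : nat := 'C(n, r) - 'C(n - s, r).

Definition rsets (T : finType) (W : {set T}) (r : nat) : {set {set T}} :=
  [set e : {set T} | (e \subset W) && (#|e| == r)].

(* The edges of HM(#|W|, r, t) on the vertex set W, with special vertices x,
   xs = x_1 ... x_(r-1) and ys = y_1 ... y_t. *)
Definition HM (T : finType) (W : {set T}) (r : nat)
    (x : T) (xs ys : seq T) : {set {set T}} :=
  [set e in rsets W r |
    [|| has (fun xi => [set x; xi] \subset e) xs,
        has (fun yj => e == [set v in rcons xs yj]) ys
      | (1 <= size ys <= r - 1) && ([set v in x :: ys] \subset e)]].

(* The edges of HM(#|W|, r, 0). *)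
Definition HM0 (T : finType) (W : {set T}) (r : nat)
    (x x1 x2 : T) : {set {set T}} :=
  [set e in rsets W r | 2 <= #|e :&: [set x; x1; x2]|].

(* xs = x_1 ... x_(r-2); z1, z2 stand for y_1', y_2'. *)
Definition HM'' (T : finType) (W : {set T}) (r : nat)
    (x : T) (xs : seq T) (y1 z1 y2 z2 : T) : {set {set T}} :=
  [set e in rsets W r |
    [|| has (fun xi => [set x; xi] \subset e) xs,
        [set x; y1; y2] \subset e, [set x; y1; z2] \subset e,
        [set x; z1; y2] \subset e, [set x; z1; z2] \subset e,
        e == [set v in xs ++ [:: y1; z1]]
      | e == [set v in xs ++ [:: y2; z2]]]].

(* |HM''(m, r)|, computed on the vertices 0 ... m-1 with 0 ... r+2 as special
   vertices; meaningful for m >= r + 3, when these are distinct. *)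
Definition hm'' (m r : nat) : nat :=
  let v : nat -> 'I_m.-1.+1 := @inord m.-1 in
  #|HM'' [set: 'I_m.-1.+1] r (v 0) [seq v i | i <- iota 1 (r - 2)]
      (v (r - 1)) (v r) (v r.+1) (v r.+2)|.

(* F \subseteq HM(#|verts F|, r, t) *)
Definition sub_HM (T : finType) (r : nat) (F : runiform T r) (t : nat) : Prop :=
  exists (x : T) (xs ys : seq T),
    [/\ size xs = r - 1, size ys = t, uniq (x :: xs ++ ys),
        {subset x :: xs ++ ys <= verts F}
      & edges F \subset HM (verts F) r x xs ys].

(* F \subseteq HM(#|verts F|, r, 0) *)
Definition sub_HM0 (T : finType) (r : nat) (F : runiform T r) : Prop :=
  exists x x1 x2 : T,
    [/\ uniq [:: x; x1; x2], {subset [:: x; x1; x2] <= verts F}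
      & edges F \subset HM0 (verts F) r x x1 x2].

Definition structured (T : finType) (r : nat) (s : nat) (H : runiform T r) :
  Prop :=
  exists Z : {set T},
    [/\ Z \subset verts H, #|Z| = s - 1
      & [\/ tau (del H Z) = 1,
            exists t : nat,
              (1 <= t <= r - 1 \/ t = #|verts H| - s + 1 - r) /\
              sub_HM (del H Z) t
          | r = 4 /\ sub_HM0 (del H Z)]].

(* Main.v *)
Require Import Defs.
From mathcomp Require Import all_boot zify.
Set Implicit Arguments.
Unset Strict Implicit.
Unset Printing Implicit Defensive.

(** First let s = 1, so that H is intersecting, and suppose that no vertex lies
    in every edge. Branching over two edges puts every edge above one of at most
    r^2 pairs, and a pair of degree more than r * C(m, r-3) meets every edge and
    every other such pair. As |H| > hm'' ~ (r-2) C(m, r-2), there are at least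
    r - 2 of these heavy pairs, so they form a triangle or contain a star with
    centre x and a set X of r - 2 leaves. A triangle gives HM(m,r,0), which is too
    small when r >= 5. For a star, the edges that miss x consist of X and a pair,
    that is, an edge of a graph G, and the edges that meet x :|: X in x alone must
    cover G. If the edges of G have a common vertex, H is in some HM(m,r,t).
    Otherwise, if G is two disjoint edges then H is in HM''(m,r), and for every
    other G the edges of these two kinds number at most 3 C(m, r-3) + O(C(m, r-4)),
    against 4 C(m, r-3) in HM''(m,r); the one exception, r = 4 with no edge meeting
    x :|: X in x alone, is inside HM(m,4,0).

    For general s, vertices of degree more than r (s+1) C(n, r-2) can be added
    greedily to a matching. Hence there are at most s of them; with s of them every
    edge meets one, with s - 1 of them deleting them leaves an intersecting family,
    and with fewer than s - 1 there are too few edges.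

    Sharpness is witnessed by all the edges that meet a fixed (s-1)-set, together
    with a copy of HM'' on the other vertices. *)

(** * Counting r-sets *)

(** Each of the j deleted points lies in at most C(n, k) of the (k+1)-sets. This bound and its
    counterpart [bin_drop_ge] trade a shift of the upper index for a term of lower order. *)
Lemma bin_drop n j k : 'C(n, k.+1) <= 'C(n - j, k.+1) + j * 'C(n, k).
Proof.
elim: j => [|j IH]; first by rewrite subn0 addn0.
apply: leq_trans IH _; rewrite mulSn addnA leq_add2r subnS.
case: (n - j) (leq_subr j n) => [|i] hi; first by rewrite leq_addr.
by rewrite binS leq_add2l leq_bin2l // ltnW.
Qed.

Lemma bin_drop_ge i j k : 'C(i, k.+1) + j * 'C(i, k) <= 'C(i + j, k.+1).
Proof.
elim: j => [|j IH]; first by rewrite !addn0.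
by rewrite addnS binS mulSn addnCA addnC leq_add // leq_bin2l ?leq_addr.
Qed.

(** The ratio of the two binomials is (n - k) / (k + 1). *)
Lemma bin_grow K k n : k + K * k.+1 <= n -> K * 'C(n, k) <= 'C(n, k.+1).
Proof.
move=> hn; rewrite -(leq_pmul2l (ltn0Sn k)) mul_bin_left mulnA leq_mul2r.
by apply/orP; right; lia.
Qed.

Lemma bin_mono n a b : a <= b -> b.*2 <= n -> 'C(n, a) <= 'C(n, b).
Proof.
elim: b => [|b IH]; first by rewrite leqn0 => /eqP->.
rewrite leq_eqVlt => /predU1P[-> //|hab] hn.
apply: leq_trans (IH hab _) _; first lia.
by rewrite -[X in X <= _]mul1n bin_grow; lia.
Qed.

Section Counting.
Variable T : finType.
Implicit Types (W A B D e : {set T}) (E F : {set {set T}}).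

Lemma card_rsets W r : #|rsets W r| = 'C(#|W|, r).
Proof. by rewrite -cards_draws; apply: eq_card => e; rewrite !inE. Qed.

(** Removing A is a bijection onto the (r - #|A|)-subsets of [W :\: D]. *)
Lemma card_trace W D A r : D \subset W -> A \subset D -> #|A| <= r ->
  #|[set e in rsets W r | e :&: D == A]| = 'C(#|W| - #|D|, r - #|A|).
Proof.
move=> sDW sAD hA.
have -> : #|W| - #|D| = #|W :\: D| by rewrite cardsD (setIidPr sDW).
rewrite -card_rsets -[RHS](@card_in_imset _ _ (fun B => B :|: A)); last first.
  move=> B C; rewrite !inE !subsetD -!andbA => /and3P[_ dB _] /and3P[_ dC _] eBC.
  have dis (X : {set T}) : [disjoint X & D] -> X = (X :|: A) :\: A.
    move=> dX; rewrite setDUl setDv setU0; apply/esym/setDidPl.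
    exact: disjointWr sAD dX.
  by rewrite (dis B dB) eBC -dis.
apply: eq_card => e; rewrite !inE; apply/andP/imsetP.
  case=> /andP[sW /eqP er] /eqP eA.
  have sAe : A \subset e by rewrite -eA subsetIl.
  exists (e :\: D).
    rewrite inE setSD //= cardsD eA er eqxx //.
  by rewrite -eA setUC setID.
case=> B; rewrite inE subsetD -andbA => /and3P[sBW dB /eqP cB] ->.
rewrite subUset sBW (subset_trans sAD sDW) /= setIUl (setIidPl sAD).
move: (dB); rewrite -setI_eq0 => /eqP->; rewrite set0U eqxx; split=> //.
rewrite cardsU cB; have -> : B :&: A = set0.
  by apply/eqP; rewrite setI_eq0; apply: disjointWr sAD dB.
by rewrite cards0 subn0 subnK.
Qed.

Lemma card_sup W A r E : E \subset rsets W r ->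
  #|[set e in E | A \subset e]| <= 'C(#|W|, r - #|A|).
Proof.
move=> sE; rewrite -card_rsets -[X in X <= _](@card_in_imset _ _ (fun e => e :\: A)); last first.
  move=> B C; rewrite !inE => /andP[_ sB] /andP[_ sC] eBC.
  by rewrite -(setID B A) -(setID C A) eBC (setIidPr sB) (setIidPr sC).
apply/subset_leq_card/subsetP => _ /imsetP[e + ->].
rewrite inE => /andP[/(subsetP sE)]; rewrite !inE => /andP[sW /eqP er] sA.
rewrite (subset_trans (subsetDl _ _) sW) /= cardsD (setIidPr sA) er eqxx //.
Qed.

Lemma card_bigcup_le (I : finType) (P : pred I) (F : I -> {set {set T}}) :
  #|\bigcup_(i | P i) F i| <= \sum_(i | P i) #|F i|.
Proof.
elim/big_rec2: _ => [|i n G _ IH]; first by rewrite cards0.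
by apply: leq_trans (leq_card_setU _ _) _; rewrite leq_add2l.
Qed.

(** An edge above A contains one of the #|B| vertices of B, and that vertex is outside A, so
    [card_sup] applies with one more prescribed vertex. The bound gains one order over [card_sup]
    itself. *)
Lemma card_sup_meet W A B r E : E \subset rsets W r -> [disjoint A & B] ->
  (forall e, e \in E -> A \subset e -> ~~ [disjoint e & B]) ->
  #|[set e in E | A \subset e]| <= #|B| * 'C(#|W|, r - #|A|.+1).
Proof.
move=> sE dAB hE; pose F v := [set e in E | v |: A \subset e].
apply: (@leq_trans (\sum_(v in B) #|F v|)).
  apply: leq_trans (card_bigcup_le _ _); apply/subset_leq_card/subsetP => e.
  rewrite inE => /andP[eE Ae]; have /pred0Pn[v /andP[/= ve vB]] := hE e eE Ae.
  by apply/bigcupP; exists v; rewrite // inE eE subUset sub1set Ae [v \in e]ve.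
rewrite -sum_nat_const leq_sum // => v vB.
have -> : #|A|.+1 = #|v |: A|.
  by rewrite cardsU1; case: (boolP (v \in A)) => // /(disjointFr dAB); rewrite vB.
exact: card_sup.
Qed.

Lemma card_traces W D (AA : {set {set T}}) r a : D \subset W -> a <= r ->
  (forall A, A \in AA -> A \subset D /\ #|A| = a) ->
  #|[set e in rsets W r | e :&: D \in AA]| = #|AA| * 'C(#|W| - #|D|, r - a).
Proof.
move=> sDW ar hA; rewrite -sum1_card (partition_big (fun e => e :&: D) [in AA]) /=.
  rewrite -sum_nat_const; apply: eq_bigr => A AAA; have [sA cA] := hA _ AAA.
  have := @card_trace W D A r sDW sA; rewrite cA => <- //; rewrite sum1_card; apply: eq_card => e.
  rewrite -topredE /= !inE; case: (e :&: D =P A) => [->|_]; last by rewrite !andbF.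
  by rewrite AAA !andbT.
by move=> e; rewrite inE => /andP[].
Qed.

Lemma card2_mem (p : {set T}) x : #|p| = 2 -> x \in p ->
  exists2 a, a != x & p = [set x; a].
Proof.
move=> /eqP/cards2P[u [v [uv ->]]]; rewrite !inE => /orP[]/eqP->.
  by exists v => //; rewrite eq_sym.
by exists u => //; rewrite setUC.
Qed.

Lemma subset_card k D : k <= #|D| -> exists2 A : {set T}, A \subset D & #|A| = k.
Proof.
move=> hk; exists [set v in take k (enum D)].
  by apply/subsetP => v; rewrite inE => /mem_take; rewrite mem_enum.
have -> : #|[set v in take k (enum D)]| = #|take k (enum D)|.
  by apply: eq_card => v; rewrite inE.
by rewrite (card_uniqP _) ?take_uniq ?enum_uniq // size_takel // -cardE.
Qed.

(** Supplies further special vertices for a construction some of whose special vertices are already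
    fixed. *)
Lemma fresh W (s : seq T) k : size s + k <= #|W| -> uniq s ->
  exists t : seq T, [/\ size t = k, uniq (s ++ t) & {subset t <= W}].
Proof.
move=> hk us; have [|A sA cA] := @subset_card k (W :\: [set v in s]).
  have cs : #|[set v in s]| = size s by rewrite cardsE; apply/card_uniqP.
  have := cardsD W [set v in s]; have := subset_leq_card (subsetIr W [set v in s]).
  by rewrite cs; lia.
exists (enum A); split; first by rewrite -cardE.
  rewrite cat_uniq us enum_uniq andbT /=; apply/hasPn => v; rewrite mem_enum.
  by move/(subsetP sA); rewrite !inE => /andP[].
by move=> v; rewrite mem_enum => /(subsetP sA); rewrite inE => /andP[].
Qed.

Lemma card_set_seq (s : seq T) : uniq s -> #|[set v in s]| = size s.
Proof. by move=> us; rewrite cardsE; apply/card_uniqP. Qed.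
End Counting.

(** * The family HM'' *)

Lemma imset_set_seq (T T' : finType) (f : T' -> T) (s : seq T') :
  f @: [set v in s] = [set v in map f s].
Proof.
apply/setP => v; rewrite !inE; apply/imsetP/mapP => -[u us ->]; exists u => //.
  by rewrite inE in us.
by rewrite inE.
Qed.

(** Injections preserve every clause of the definition, so the count made on ordinals in [hm'']
    carries over to any vertex set. *)
Lemma card_HM''_imset (T T' : finType) (f : T' -> T) (W : {set T'}) r x xs y1 z1 y2 z2 :
  injective f ->
  #|HM'' (f @: W) r (f x) (map f xs) (f y1) (f z1) (f y2) (f z2)| =
  #|HM'' W r x xs y1 z1 y2 z2|.
Proof.
move=> finj; rewrite -[RHS](card_imset _ (imset_inj finj)).
have sub2 a b (e : {set T'}) : ([set f a; f b] \subset f @: e) = ([set a; b] \subset e).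
  by rewrite !subUset !sub1set !(mem_imset _ _ finj).
have sub3 a b c (e : {set T'}) :
    ([set f a; f b; f c] \subset f @: e) = ([set a; b; c] \subset e).
  by rewrite !subUset !sub1set !(mem_imset _ _ finj).
have mem (e : {set T'}) :
    (f @: e \in HM'' (f @: W) r (f x) (map f xs) (f y1) (f z1) (f y2) (f z2)) =
    (e \in HM'' W r x xs y1 z1 y2 z2).
  rewrite !inE (card_imset _ finj) !sub3 has_map.
  have -> : f @: e \subset f @: W = (e \subset W).
    apply/idP/idP => [/subsetP h|]; last exact: imsetS.
    by apply/subsetP => v ve; rewrite -(mem_imset _ _ finj); apply/h/imset_f.
  congr (_ && [|| _, _, _, _, _, _ | _]).
  - by apply: eq_has => v /=; rewrite sub2.
  - by rewrite -[[:: f y1; _]]/(map f [:: y1; z1]) -map_cat -imset_set_seq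
               (inj_eq (imset_inj finj)).
  - by rewrite -[[:: f y2; _]]/(map f [:: y2; z2]) -map_cat -imset_set_seq
               (inj_eq (imset_inj finj)).
apply: eq_card => e; apply/idP/imsetP => [he|[e' he' ->]]; last by rewrite mem.
suff ee : e = f @: (f @^-1: e) by exists (f @^-1: e) => //; rewrite -mem -ee.
move: (he); rewrite !inE => /andP[/andP[/subsetP sW _] _].
apply/setP => v; apply/idP/imsetP => [ve|[u + ->]]; last by rewrite inE.
by have /imsetP[u _ vu] := sW v ve; exists u; rewrite // inE -vu.
Qed.

Lemma card_HM'' (T : finType) (W : {set T}) r x xs y1 z1 y2 z2 :
  2 <= r -> size xs = r - 2 -> uniq (x :: xs ++ [:: y1; z1; y2; z2]) ->
  {subset x :: xs ++ [:: y1; z1; y2; z2] <= W} ->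
  #|HM'' W r x xs y1 z1 y2 z2| = hm'' #|W| r.
Proof.
move=> hr szx; set sp := (_ :: _); move=> usp ssp.
have szsp : size sp = r + 3 by rewrite /= size_cat szx /=; lia.
(* Listing W with the special vertices first makes [f] send the special ordinals 0, ..., r+2 of
   [hm''] to the given special vertices. *)
pose s := sp ++ [seq v <- enum W | v \notin sp].
have us : uniq s.
  rewrite cat_uniq usp filter_uniq ?enum_uniq // andbT /=.
  by apply/hasPn => v; rewrite mem_filter => /andP[].
have ms : s =i W.
  move=> v; rewrite mem_cat mem_filter mem_enum.
  by case: (boolP (v \in sp)) => [/ssp->|].
have szs : size s = #|W| by rewrite -(card_uniqP us); apply: eq_card.
have hW : r + 3 <= #|W| by rewrite -szs size_cat szsp leq_addr.
set m := #|W| in szs hW *; have m0 : m.-1.+1 = m by lia.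
pose f (i : 'I_m.-1.+1) := nth x s i.
have lt_i (i : 'I_m.-1.+1) : i < size s by rewrite szs -{2}m0.
have finj : injective f.
  by move=> i j /eqP; rewrite nth_uniq // => /eqP/val_inj.
have WE : W = f @: setT.
  apply/setP => v; rewrite -ms; apply/idP/imsetP => [vs|[i _ ->]]; last exact: mem_nth.
  have h : index v s < m.-1.+1 by rewrite m0 -szs index_mem.
  by exists (Ordinal h); rewrite // /f nth_index.
have fE i : i < r + 3 -> f (inord i) = nth x sp i.
  by move=> hi; rewrite /f inordK ?m0; [rewrite nth_cat szsp hi | lia].
rewrite /hm'' -(card_HM''_imset _ _ _ _ _ _ _ _ finj) -WE.
rewrite -map_comp !fE; try lia.
have -> : [seq (f \o inord) i | i <- iota 1 (r - 2)] = xs.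
  apply: (@eq_from_nth _ x); rewrite size_map size_iota ?szx // => i hi.
  rewrite (nth_map 0) ?size_iota // nth_iota //= fE; last lia.
  by rewrite add1n /sp /= nth_cat szx hi.
have nthsp i : nth x sp (r - 1 + i) = nth x [:: y1; z1; y2; z2] i.
  have -> : r - 1 + i = (r - 2 + i).+1 by lia.
  by rewrite /sp /= nth_cat szx ltnNge leq_addr /= addKn.
have := (nthsp 0, nthsp 1, nthsp 2, nthsp 3) => /= -[[[]]].
have -> : r - 1 + 1 = r by lia.
have -> : r - 1 + 2 = r.+1 by lia.
have -> : r - 1 + 3 = r.+2 by lia.
by rewrite addn0 /= => -> -> -> ->.
Qed.

Section HMfacts.
Variables (T : finType) (W : {set T}) (r : nat).
Implicit Types (e : {set T}).

Lemma HM''_pair e x xs y1 z1 y2 z2 v : e \in rsets W r -> x \in e -> v \in xs ->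
  v \in e -> e \in HM'' W r x xs y1 z1 y2 z2.
Proof.
move=> er xe vxs ve; rewrite inE er /=; apply/orP; left; apply/hasP; exists v => //.
by rewrite subUset !sub1set xe.
Qed.

Lemma HM''_trans e x xs y1 z1 y2 z2 : e \in rsets W r -> x \in e ->
  (y1 \in e) || (z1 \in e) -> (y2 \in e) || (z2 \in e) ->
  e \in HM'' W r x xs y1 z1 y2 z2.
Proof.
move=> er xe h1 h2; rewrite inE er /=; apply/orP; right.
rewrite !subUset !sub1set xe /=.
by case: (y1 \in e) h1; case: (z1 \in e) => //= _;
   case: (y2 \in e) h2; case: (z2 \in e) => //= _; rewrite ?orbT.
Qed.

(** The r-sets that meet [x :: xs] exactly in x and one x_i are edges, and distinct i give distinct
    traces. This is the leading term of [hm'']. *)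
Lemma hm''_ge : 4 <= r -> r + 3 <= #|W| ->
  (r - 2) * 'C(#|W| - (r - 1), r - 2) <= hm'' #|W| r.
Proof.
move=> r4 hW; have [//|//|sp [szs us sW]] := @fresh T W [::] (r + 3).
case: sp szs us sW => [|x s] /=; first lia.
move=> szs us sW; set xs := take (r - 2) s.
have szx : size xs = r - 2 by rewrite size_takel; lia.
have : size (drop (r - 2) s) = 4 by rewrite size_drop; lia.
case ed : (drop (r - 2) s) => [|y1 [|z1 [|y2 [|z2 []]]]] //= _.
have es : s = xs ++ [:: y1; z1; y2; z2] by rewrite -ed cat_take_drop.
rewrite -(@card_HM'' T W r x xs y1 z1 y2 z2) -?es //; last lia.
move: us => /andP[xs' us]; have uxs : uniq (x :: xs).
  rewrite /= take_uniq // andbT; apply: contra xs'; exact: mem_take.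
have sDW : [set v in x :: xs] \subset W.
  apply/subsetP => v; rewrite inE => hv; apply: sW; move: hv.
  by rewrite !inE => /orP[->//|/mem_take->]; rewrite orbT.
pose AA := [set [set x; v] | v in xs].
have cAA : #|AA| = r - 2.
  rewrite card_in_imset; first by rewrite -szx; apply/card_uniqP; case/andP: uxs.
  move=> u v uxs' vxs /setP/(_ u); rewrite !inE eqxx orbT => /esym/orP[]/eqP// ux.
  by move: uxs; rewrite /= -ux uxs'.
rewrite -[X in X * _]cAA -[X in _ - X](_ : #|[set v in x :: xs]| = _); last first.
  by rewrite card_set_seq //= szx; lia.
rewrite -card_traces //; last first.
- move=> A /imsetP[v vxs ->]; split.
    by apply/subsetP => u; rewrite !inE => /orP[]/eqP->; rewrite ?eqxx ?vxs ?orbT.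
  by rewrite cards2; case: eqP => // xv; move: uxs; rewrite /= xv vxs.
- lia.
apply/subset_leq_card/subsetP => e; rewrite inE => /andP[er /imsetP[v vxs ev]].
have: (x \in e :&: [set v in x :: xs]) && (v \in e :&: [set v in x :: xs]).
  by rewrite ev !inE !eqxx orbT.
by rewrite !in_setI => /andP[/andP[xe _] /andP[ve _]]; apply: HM''_pair xe vxs ve.
Qed.
End HMfacts.

(** * Intersecting families *)

Section Core.
Variables (T : finType) (W : {set T}) (r : nat) (E : {set {set T}}).
Hypothesis r4 : 4 <= r.
Hypothesis sE : E \subset rsets W r.
Hypothesis hI : {in E &, forall e f : {set T}, ~~ [disjoint e & f]}.
Hypothesis htau : forall v, exists2 e, e \in E & v \notin e.
Hypothesis hm : 4 * r <= #|W|.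
(* The sense in which W is large: each binomial dominates the previous one. *)
Hypothesis grow : forall k, k < r ->
  20 * (r * r * r) * 'C(#|W|, k) <= 'C(#|W|, k.+1).
Hypothesis hE : hm'' #|W| r < #|E|.

Let m := #|W|.

(** * Pairs of large degree *)

Lemma edge_sub e : e \in E -> e \subset W.
Proof. by move=> /(subsetP sE); rewrite inE => /andP[]. Qed.

Lemma edge_card e : e \in E -> #|e| = r.
Proof. by move=> /(subsetP sE); rewrite inE => /andP[_ /eqP]. Qed.

(* If some edge misses p, then the edges above p meet it and so number at most
   r * 'C(m, r - 3). *)
Definition big_pairs : {set {set T}} :=
  [set p in rsets W 2 | r * 'C(m, r - 3) < #|[set e in E | p \subset e]|].
Local Notation P := big_pairs.

Lemma big_pairs_card p : p \in P -> #|p| = 2.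
Proof. by rewrite inE => /andP[]; rewrite inE => /andP[_ /eqP]. Qed.

Lemma big_pairs_cover p e : p \in P -> e \in E -> ~~ [disjoint p & e].
Proof.
move=> pP eE; move: (pP); rewrite inE => /andP[_]; apply: contraTN => dpe.
rewrite -leqNgt; have := @card_sup_meet T W p e r E sE dpe.
by rewrite (edge_card eE) (big_pairs_card pP); apply => f fE _; apply: hI.
Qed.

(** If q were disjoint from p, every edge above p would still meet q by [big_pairs_cover], so at
    most 2 C(m, r-3) edges would lie above p. *)
Lemma big_pairs_meet p q : p \in P -> q \in P -> ~~ [disjoint p & q].
Proof.
move=> pP qP; move: (pP); rewrite inE => /andP[_]; apply: contraTN => dpq.
rewrite -leqNgt; have := @card_sup_meet T W p q r E sE dpq.
rewrite (big_pairs_card pP) (big_pairs_card qP) => h; apply: leq_trans (h _) _.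
  by move=> f fE _; rewrite disjoint_sym big_pairs_cover.
by rewrite leq_mul2r; apply/orP; right; lia.
Qed.

(** The second branching edge depends on the first choice: an edge meets [e1] in some v, and then
    meets the edge [e2 v], chosen to miss v. The resulting two vertices are therefore distinct. *)
Lemma card_le_big_pairs : #|E| <= #|P| * 'C(m, r - 2) + r * r * (r * 'C(m, r - 3)).
Proof.
have [e1 e1E] : exists e1, e1 \in E by apply/card_gt0P; lia.
pose e2 v := odflt set0 [pick e in E | v \notin e].
have e2P v : e2 v \in E /\ v \notin e2 v.
  rewrite /e2; case: pickP => [e /andP[]//|h].
  by have [e eE ve] := htau v; move: (h e); rewrite eE ve.
pose Q := \bigcup_(v in e1) [set [set v; w] | w in e2 v].
have cQ : #|Q| <= r * r.
  apply: leq_trans (card_bigcup_le _ _) _; rewrite -{1}(edge_card e1E) -sum_nat_const.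
  by apply: leq_sum => v _; rewrite -(edge_card (e2P v).1) leq_imset_card.
have QP q : q \in Q -> q \in rsets W 2.
  move=> /bigcupP[v ve1 /imsetP[w we2 ->]]; have [e2E ve2] := e2P v.
  rewrite inE subUset !sub1set (subsetP (edge_sub e1E)) ?(subsetP (edge_sub e2E)) //=.
  by rewrite cards2; case: (v =P w) => // vw; move: ve2; rewrite -vw in we2; rewrite we2.
apply: (@leq_trans (\sum_(q in Q) #|[set e in E | q \subset e]|)).
  apply: leq_trans (card_bigcup_le _ _); apply/subset_leq_card/subsetP => e eE.
  have /pred0Pn[v /andP[/= ve ve1]] := hI eE e1E.
  have [e2E ve2] := e2P v; have /pred0Pn[w /andP[/= we we2]] := hI eE e2E.
  apply/bigcupP; exists [set v; w]; last by rewrite inE eE subUset !sub1set [v \in e]ve.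
  by apply/bigcupP; exists v => //; apply: imset_f.
apply: (@leq_trans (\sum_(q in Q) ((q \in P) * 'C(m, r - 2) + r * 'C(m, r - 3)))).
  apply: leq_sum => q qQ; case: (boolP (q \in P)) => [qP|].
    rewrite mul1n; apply: leq_trans (leq_addr _ _).
    by have := card_sup q sE; rewrite (big_pairs_card qP).
  by rewrite inE QP //= -leqNgt mul0n.
rewrite big_split /= leq_add //.
  rewrite -big_distrl /= leq_mul2r -sum1_card; apply/orP; right.
  rewrite big_mkcond [X in _ <= X]big_mkcond /=; apply: leq_sum => q _.
  by case: (q \in Q); case: (q \in P).
by rewrite sum_nat_const leq_mul2r cQ orbT.
Qed.

(** Put a = C(m, r-2) and b = C(m, r-3). With at most r - 3 big pairs, #|E| <= (r-3) a + r^3 b,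
    while [hm''_ge] and [bin_drop] give #|E| > (r-2) a - (r-2)(r-1) b. Hence a < 2 r^3 b, against
    [grow]. *)
Lemma big_pairs_many : r - 2 <= #|P|.
Proof.
rewrite leqNgt; apply/negP => hP.
have h1 := card_le_big_pairs.
have h2 : (r - 2) * 'C(m - (r - 1), r - 2) < #|E|.
  by apply: leq_ltn_trans (hm''_ge _ _) hE => //; lia.
have := @bin_drop m (r - 1) (r - 3); have := @grow (r - 3).
have -> : (r - 3).+1 = r - 2 by lia.
move: h1 h2; set a := 'C(m, r - 2); set b := 'C(m, r - 3); set c := 'C(_, _).
move=> h1 h2 h3 h4; have {}h3 := h3 ltac:(lia).
have b0 : 0 < b by rewrite bin_gt0 /m; lia.
have hPa : #|P| * a <= (r - 3) * a by rewrite leq_mul2r; lia.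
have h5 : (r - 2) * a <= (r - 2) * (c + (r - 1) * b) by rewrite leq_mul2l h4 orbT.
have h6 : (r - 2) * a = (r - 3) * a + a by rewrite -{3}[a]mul1n -mulnDl; congr (_ * a); lia.
have h7 : (r - 2) * ((r - 1) * b) <= r * r * r * b.
  by rewrite mulnA leq_mul2r; apply/orP; right; rewrite -mulnA leq_mul ?leq_subr //; nia.
have z0 : 0 < r * r * r * b by rewrite !muln_gt0 b0 andbT; lia.
move: h1 h2 h3 h5 h7 z0 hPa; rewrite h6 mulnDr -[20 * _ * b]mulnA.
rewrite [r * r * (r * b)]mulnA.
move: (r * r * r * b) (#|P| * a) ((r - 3) * a) ((r - 2) * c) ((r - 2) * _) #|E|.
clear; lia.
Qed.

(** * Triangles and stars of big pairs *)

Lemma two_of_three (e : {set T}) a b c : uniq [:: a; b; c] ->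
  (a \in e) || (b \in e) -> (a \in e) || (c \in e) -> (b \in e) || (c \in e) ->
  2 <= #|e :&: [set a; b; c]|.
Proof.
rewrite /= !inE !andbT negb_or => /andP[/andP[ab ac] bc] h1 h2 h3.
have key u v : u != v -> u \in e -> v \in e -> [set u; v] \subset [set a; b; c] ->
    2 <= #|e :&: [set a; b; c]|.
  move=> uv ue ve suv; have <- : #|[set u; v]| = 2 by rewrite cards2 uv.
  apply: subset_leq_card.
  by rewrite subsetI suv subUset !sub1set ue ve.
have [ae|ae] := boolP (a \in e); last first.
  apply: (key b c) => //; first by move: h1; rewrite (negPf ae).
    by move: h2; rewrite (negPf ae).
  by rewrite subUset !sub1set !inE !eqxx !orbT.
have [be|be] := boolP (b \in e).
  by apply: (key a b) => //; rewrite subUset !sub1set !inE !eqxx !orbT.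
apply: (key a c) => //; first by move: h3; rewrite (negPf be).
by rewrite subUset !sub1set !inE !eqxx !orbT.
Qed.

Lemma pair_meet (a b : T) (e : {set T}) :
  ~~ [disjoint [set a; b] & e] = (a \in e) || (b \in e).
Proof.
apply/pred0Pn/orP => [[v /andP[]]|[h|h]].
- by rewrite /= !inE => /orP[]/eqP->; [left|right].
- by exists a; rewrite /= !inE eqxx.
- by exists b; rewrite /= !inE eqxx orbT.
Qed.

(** Take two big pairs {x, a} and {x, b}. If some big pair misses x, it meets both and so equals {a,
    b}; an edge that meets all three pairs has two of x, a, b. Otherwise all big pairs contain x,
    and an edge missing x must contain all their other ends, of which r - 2 are kept as X. *)
Lemma triangle_or_star :
  (exists a b c, [/\ uniq [:: a; b; c], [set a; b; c] \subset W &
     forall e, e \in E -> 2 <= #|e :&: [set a; b; c]|]) \/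
  (exists x (X : {set T}), [/\ x \in W, X \subset W, x \notin X, #|X| = r - 2 &
     forall e, e \in E -> x \notin e -> X \subset e]).
Proof.
have PW p : p \in P -> p \subset W.
  by rewrite inE => /andP[]; rewrite inE => /andP[].
have /card_gt1P[p [q [pP qP pq]]] : 1 < #|P|.
  by have := big_pairs_many; lia.
have /pred0Pn[x /andP[/= xp xq]] := big_pairs_meet pP qP.
have [a ax pE] := card2_mem (big_pairs_card pP) xp.
have [b bx qE] := card2_mem (big_pairs_card qP) xq.
have ab : a != b by apply: contraNneq pq => ab; rewrite pE qE ab.
have [/forallP hx|] := boolP [forall p in P, x \in p].
  right; pose L := [set v in W | (v != x) && ([set x; v] \in P)].
  have LE v : (v \in L) = [&& v \in W, v != x & [set x; v] \in P] by rewrite inE.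
  have : r - 2 <= #|L|.
    apply: leq_trans big_pairs_many _; apply: leq_trans (leq_imset_card (fun v => [set x; v]) _).
    apply/subset_leq_card/subsetP => p' p'P.
    have [v vx pv] := card2_mem (big_pairs_card p'P) (implyP (hx p') p'P).
    apply/imsetP; exists v => //; rewrite LE vx -pv p'P andbT.
    by rewrite (subsetP (PW _ p'P)) // pv !inE eqxx orbT.
  move=> /subset_card[X sXL cX]; exists x, X; split=> //.
  - exact: subsetP (PW _ pP) _ xp.
  - by apply: subset_trans sXL _; apply/subsetP => v; rewrite LE => /andP[].
  - by apply/negP => /(subsetP sXL); rewrite LE eqxx andbF.
  - move=> e eE xe; apply/subsetP => v /(subsetP sXL); rewrite LE => /and3P[_ _ vP].
    by have := big_pairs_cover vP eE; rewrite pair_meet (negPf xe).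
rewrite negb_forall => /existsP[p3]; rewrite negb_imply => /andP[p3P xp3].
left; exists x, a, b.
have xab : uniq [:: x; a; b] by rewrite /= !inE negb_or eq_sym ax eq_sym bx ab.
have ap3 : a \in p3.
  by have := big_pairs_meet pP p3P; rewrite pE pair_meet (negPf xp3).
have bp3 : b \in p3.
  by have := big_pairs_meet qP p3P; rewrite qE pair_meet (negPf xp3).
have p3E : p3 = [set a; b].
  apply/esym/eqP; rewrite eqEcard subUset !sub1set ap3 bp3 (big_pairs_card p3P) /=.
  by rewrite cards2 ab.
split=> //.
  rewrite !subUset !sub1set (subsetP (PW _ pP)) // (subsetP (PW _ p3P)) //.
  by rewrite (subsetP (PW _ p3P)).
move=> e eE; apply: two_of_three => //.
- by have := big_pairs_cover pP eE; rewrite pE pair_meet.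
- by have := big_pairs_cover qP eE; rewrite qE pair_meet.
- by have := big_pairs_cover p3P eE; rewrite p3E pair_meet.
Qed.

(** For r = 5 the r-sets with two points in the triangle and [HM''] have the same leading term 3
    C(m, r-2), so leading terms do not suffice. Instead [K] is placed with centre a and with b, c, d
    among its leaves, and the two differences of E and [K] are compared. *)
Lemma no_triangle a b c : 5 <= r -> uniq [:: a; b; c] -> [set a; b; c] \subset W ->
  (forall e, e \in E -> 2 <= #|e :&: [set a; b; c]|) -> False.
Proof.
move=> r5 uabc sabc h2; have [|t [szt ut tW]] := @fresh T W [:: a; b; c] r _ uabc.
  by move: hm; rewrite /=; lia.
case: t szt ut tW => [|d t] /= szt ut tW; first by move: szt; lia.
set l := take (r - 5) t.
have szl : size l = r - 5 by rewrite size_takel; clear -szt r5; lia.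
have : size (drop (r - 5) t) = 4 by rewrite size_drop; clear -szt r5; lia.
case ed : (drop (r - 5) t) => [|y1 [|z1 [|y2 [|z2 []]]]] //= _.
have et : t = l ++ [:: y1; z1; y2; z2] by rewrite -ed cat_take_drop.
pose xs := b :: c :: d :: l; set K := HM'' W r a xs y1 z1 y2 z2.
have eD : a :: xs ++ [:: y1; z1; y2; z2] = [:: a; b; c] ++ d :: t by rewrite et.
have uD : uniq (a :: xs ++ [:: y1; z1; y2; z2]) by rewrite eD.
have sD : {subset a :: xs ++ [:: y1; z1; y2; z2] <= W}.
  move=> v; rewrite eD mem_cat => /orP[v3|]; last exact: tW.
  by apply: (subsetP sabc); move: v3; rewrite !inE orbA.
have cK : #|K| = hm'' m r by apply: card_HM'' => //=; clear -szl r5; lia.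
(* Edges outside K avoid a and contain b and c: at most 'C(m - 3, r - 2) of them.
   K makes up for these with the r-sets of trace [set a; d] on a, b, c, d, and
   those of trace [set a; y1; y2] or [set a; z1; z2] on the special vertices. *)
suff : #|E :\: K| <= #|K :\: E|.
  have := (cardsID K E, cardsID E K); rewrite setIC cK => -[].
  by move: hE; rewrite -/m; clear; lia.
have U : uniq [:: a; b; c; d; y1; z1; y2; z2].
  apply: subseq_uniq uD; rewrite -[_ :: _]/([:: a; b; c; d] ++ [:: y1; z1; y2; z2]).
  rewrite -[X in subseq _ X]/([:: a; b; c; d] ++ (l ++ [:: y1; z1; y2; z2])).
  by rewrite cat_subseq ?suffix_subseq.
have D'W : [set v in a :: xs ++ [:: y1; z1; y2; z2]] \subset W.
  by apply/subsetP => v; rewrite inE => /sD.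
have eabc : [set a; b; c] = [set v in [:: a; b; c]].
  by apply/setP => v; rewrite !inE orbA.
have notE (e : {set T}) : a \in e -> b \notin e -> c \notin e -> e \notin E.
  move=> ae be ce; apply/negP => eE; have := h2 e eE; rewrite leqNgt => /negP; apply.
  rewrite ltnS -(cards1 a) subset_leq_card //; apply/subsetP => v; rewrite !inE => /andP[ve].
  by case/orP=> [/orP[//|]|] /eqP vv; rewrite vv ?(negPf be) ?(negPf ce) in ve.
have cE : #|E :\: K| <= 'C(m - 3, r - 2).
  have bc : b != c by move: uabc; rewrite /= !inE => /and3P[].
  have c2 : #|[set b; c]| = 2 by rewrite cards2 bc.
  have := @card_trace T W [set v in [:: a; b; c]] [set b; c] r.
  rewrite card_set_seq // c2 -eabc => <- //; last first.
  - by clear -r5; lia.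
  - by rewrite subUset !sub1set !inE !eqxx !orbT.
  apply/subset_leq_card/subsetP => e; rewrite inE => /andP[eK eE].
  have er := subsetP sE _ eE; rewrite inE er /=.
  have ae : a \notin e.
    apply: contra eK => ae; have [be|be] := boolP (b \in e).
      by apply: HM''_pair er ae _ be; rewrite !inE eqxx.
    have [ce|ce] := boolP (c \in e).
      by apply: HM''_pair er ae _ ce; rewrite !inE eqxx orbT.
    by have := notE e ae be ce; rewrite eE.
  rewrite eqEcard c2 h2 // andbT; apply/subsetP => v; rewrite !inE => /andP[ve].
  by case/orP => [/orP[/eqP va|->//]|->]; [rewrite -va ve in ae|rewrite orbT].
have tr (D A e : {set T}) (v : T) : e :&: D = A -> v \in D -> (v \in e) = (v \in A).
  by move=> <- vD; rewrite inE vD andbT.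
pose S1 := [set e in rsets W r | e :&: [set v in [:: a; b; c; d]] == [set a; d]].
pose AA := [set [set a; y1; y2]; [set a; z1; z2]].
pose S2 := [set e in rsets W r | e :&: [set v in a :: xs ++ [:: y1; z1; y2; z2]] \in AA].
have cS1 : #|S1| = 'C(m - 4, r - 2).
  have c2 : #|[set a; d]| = 2 by rewrite cards2; move: U; rewrite /= !inE; case: (a == d); rewrite ?orbT.
  rewrite /S1 card_trace ?c2 ?card_set_seq //.
  - by apply: subseq_uniq U; rewrite -[X in subseq _ X]/([:: a; b; c; d] ++ _) prefix_subseq.
  - apply: subset_trans D'W; apply/subsetP => v; rewrite !inE.
    by case/or4P => ->; rewrite ?orbT.
  - by rewrite subUset !sub1set !inE !eqxx ?orbT.
  - by clear -r5; lia.
have cS2 : #|S2| = 2 * 'C(m - (r + 3), r - 3).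
  have r3 : 3 <= r by clear -r5; lia.
  rewrite /S2 (@card_traces _ _ _ _ _ 3) //.
    rewrite card_set_seq // /= size_cat /= szl /AA cards2.
    have -> : [set a; y1; y2] != [set a; z1; z2].
      apply/eqP => /setP/(_ y1); rewrite !inE eqxx orbT => /esym h; move: U.
      by case/orP: h => [/orP[]|] /eqP h; rewrite h /= !inE eqxx ?orbT ?andbF.
    by congr (_ * 'C(_ - _, _)); clear -r5 szl; lia.
  have c3 u v w : uniq [:: u; v; w] -> #|[set u; v; w]| = 3.
    move=> h; rewrite -[RHS]/(size [:: u; v; w]) -card_set_seq //.
    by apply: eq_card => i; rewrite !inE orbA.
  move=> A; rewrite !inE => /orP[]/eqP->; split.
  - by rewrite !subUset !sub1set !inE !mem_cat !inE !eqxx ?orbT.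
  - apply: c3; apply: subseq_uniq U.
    by rewrite /= !eqxx; do !case: eqP => //.
  - by rewrite !subUset !sub1set !inE !mem_cat !inE !eqxx ?orbT.
  - apply: c3; apply: subseq_uniq U.
    by rewrite /= !eqxx; do !case: eqP => //.
have disS : [disjoint S1 & S2].
  rewrite -setI_eq0; apply/eqP/setP => e; rewrite in_setI in_set0 [e \in S1]inE [e \in S2]inE.
  apply/negP => /andP[/andP[_ /eqP e1] /andP[_ e2]].
  have de : d \in e by rewrite (tr _ _ _ _ e1) !inE eqxx ?orbT.
  have d1 : d \in [set v in a :: xs ++ [:: y1; z1; y2; z2]] by rewrite !inE eqxx !orbT.
  move: de U; case/set2P: e2 => /tr -> //; rewrite !inE => /orP[/orP[]|] /eqP->;
    by rewrite /= !inE !eqxx ?orbT ?andbF.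
have mk (e : {set T}) : a \in e -> b \notin e -> c \notin e -> e \in K -> e \in K :\: E.
  by move=> ae be ce eK; rewrite inE notE.
have sS : S1 :|: S2 \subset K :\: E.
  apply/subsetP => e; rewrite inE => /orP[]; rewrite inE => /andP[er].
    move=> /eqP e1; have h v : v \in [:: a; b; c; d] -> (v \in e) = (v \in [set a; d]).
      by move=> hv; rewrite -e1 in_setI [v \in [set _ in _]]inE hv andbT.
    apply: mk.
    - by rewrite h ?inE ?eqxx ?orbT.
    - rewrite h ?inE ?eqxx ?orbT //.
      by apply/negP => /orP[] /eqP eb; move: U; rewrite eb /= !inE !eqxx ?orbT ?andbF.
    - rewrite h ?inE ?eqxx ?orbT //.
      by apply/negP => /orP[] /eqP eb; move: U; rewrite eb /= !inE !eqxx ?orbT ?andbF.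
    - have dxs : d \in xs by rewrite /xs !inE eqxx !orbT.
      by apply: (HM''_pair _ _ _ _ er _ dxs); rewrite h !inE eqxx ?orbT.
  move=> /set2P e2.
  have memD v : v \in [:: a; b; c; y1; z1; y2; z2] ->
      v \in [set v in a :: xs ++ [:: y1; z1; y2; z2]].
    rewrite !inE mem_cat !inE.
    by do ![case/orP; [by move=> ->; rewrite ?orbT|]]; move=> ->; rewrite ?orbT.
  have [h|h] : (forall v, v \in [:: a; b; c; y1; z1; y2; z2] -> (v \in e) = (v \in [set a; y1; y2]))
    \/ (forall v, v \in [:: a; b; c; y1; z1; y2; z2] -> (v \in e) = (v \in [set a; z1; z2])).
  - by case: e2 => e2; [left|right] => v /memD; apply: tr.
  - apply: mk.
    + by rewrite h ?inE ?eqxx ?orbT.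
    + rewrite h ?inE ?eqxx ?orbT //.
      by apply/negP => /orP[/orP[]|] /eqP eb; move: U; rewrite eb /= !inE !eqxx ?orbT ?andbF.
    + rewrite h ?inE ?eqxx ?orbT //.
      by apply/negP => /orP[/orP[]|] /eqP eb; move: U; rewrite eb /= !inE !eqxx ?orbT ?andbF.
    + have [ae v1 v2] : [/\ a \in e, y1 \in e & y2 \in e].
        by split; rewrite h !inE !eqxx ?orbT.
      by apply: HM''_trans; rewrite ?v1 ?v2 ?orbT.
  - apply: mk.
    + by rewrite h ?inE ?eqxx ?orbT.
    + rewrite h ?inE ?eqxx ?orbT //.
      by apply/negP => /orP[/orP[]|] /eqP eb; move: U; rewrite eb /= !inE !eqxx ?orbT ?andbF.
    + rewrite h ?inE ?eqxx ?orbT //.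
      by apply/negP => /orP[/orP[]|] /eqP eb; move: U; rewrite eb /= !inE !eqxx ?orbT ?andbF.
    + have [ae v1 v2] : [/\ a \in e, z1 \in e & z2 \in e].
        by split; rewrite h !inE !eqxx ?orbT.
      by apply: HM''_trans; rewrite ?v1 ?v2 ?orbT.
apply: leq_trans cE (leq_trans _ (subset_leq_card sS)).
rewrite cardsU (disjoint_setI0 disS) cards0 subn0 cS1 cS2.
(* After Pascal's rule [S1] cancels the first summand, and C(m-4, r-3) is left for [S2]. The factor
   2 from the two traces absorbs the loss in passing from m - 4 to m - (r + 3). *)
have -> : r - 2 = (r - 3).+1 by clear -r5; lia.
have h1 : 'C(m - 3, (r - 3).+1) = 'C(m - 4, (r - 3).+1) + 'C(m - 4, r - 3).
  by rewrite -binS; congr 'C(_, _); rewrite /m; clear -r5 hm; lia.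
rewrite h1 leq_add2l.
have h2' : 'C(m, r - 3) <= 'C(m - (r + 3), r - 3) + (r + 3) * 'C(m, r - 4).
  by have := @bin_drop m (r + 3) (r - 4); have -> : (r - 4).+1 = r - 3 by clear -r5; lia.
have := @grow (r - 4); have -> : (r - 4).+1 = r - 3 by clear -r5; lia.
move/(_ ltac:(clear -r5; lia)) ; rewrite -/m => h3.
have h4 : 'C(m - 4, r - 3) <= 'C(m, r - 3) by rewrite leq_bin2l ?leq_subr.
have h5 : 2 * (r + 3) * 'C(m, r - 4) <= 20 * (r * r * r) * 'C(m, r - 4).
  by rewrite leq_mul2r; apply/orP; right; clear -r5; nia.
move: h2' h3 h4 h5; rewrite -[2 * _ * _]mulnA; clear; lia.
Qed.

(** An edge missing x is X with one more vertex, taken from [Y]. An edge through x that misses X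
    must meet all these edges, hence contains [Y]. So [Y] plays the role of the y_j, if it is small
    enough. *)
Lemma star_HM x (X : {set T}) : x \in W -> X \subset W -> x \notin X ->
  #|X| = r - 1 -> (forall e, e \in E -> x \notin e -> X \subset e) ->
  exists xs ys, [/\ size xs = r - 1, uniq (x :: xs ++ ys),
    {subset x :: xs ++ ys <= W}, 1 <= size ys <= r - 1 \/ size ys = m - r
    & E \subset HM W r x xs ys].
Proof.
move=> xW XW xX cX hX; pose xs := enum X.
have szx : size xs = r - 1 by rewrite -cardE.
pose Y := [set y in W | [&& y \notin X, y != x & y |: X \in E]].
have eY e : e \in E -> x \notin e -> exists2 y, y \in Y & e = y |: X.
  move=> eE xe; have sX := hX e eE xe.
  have /eqP/cards1P[y ey] : #|e :\: X| = 1.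
    by rewrite cardsD (setIidPr sX) cX (edge_card eE); lia.
  have eyX : e = y |: X by rewrite -ey setUC -{1}(setIidPr sX) setID.
  have : y \in e :\: X by rewrite ey set11.
  rewrite inE => /andP[yX ye]; exists y => //.
  rewrite inE yX -eyX eE (subsetP (edge_sub eE)) //= andbT.
  by apply: contraNneq xe => <-.
have [e0 e0E xe0] := htau x.
have Y0 : 0 < #|Y| by have [y yY _] := eY e0 e0E xe0; apply/card_gt0P; exists y.
have xY e : e \in E -> x \in e -> [disjoint e & X] -> Y \subset e.
  move=> eE xe dX; apply/subsetP => y; rewrite inE => /and4P[_ yX _ yXE].
  have /pred0Pn[v /andP[/= ve]] := hI eE yXE.
  by rewrite !inE => /orP[/eqP<-//|]; rewrite (disjointFr dX ve).
have finish (ys : seq T) : uniq ys -> {subset ys <= W} ->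
    (forall v, v \in ys -> (v \notin X) && (v != x)) ->
    {subset Y <= ys} ->
    (forall e, e \in E -> x \in e -> [disjoint e & X] ->
       (1 <= size ys <= r - 1) && ([set v in ys] \subset e)) ->
    [/\ size xs = r - 1, uniq (x :: xs ++ ys),
      {subset x :: xs ++ ys <= W} & E \subset HM W r x xs ys].
  move=> uys ysW ysX Yys hys; split=> //.
  - rewrite /= cat_uniq enum_uniq uys andbT mem_cat mem_enum negb_or xX /=.
    apply/andP; split; first by apply/negP => /ysX; rewrite eqxx andbF.
    by apply/hasPn => v /ysX/andP[]; rewrite /= mem_enum.
  - move=> v; rewrite inE mem_cat mem_enum => /or3P[/eqP->//|/(subsetP XW)//|/ysW//].
  - apply/subsetP => e eE; rewrite inE (subsetP sE _ eE) /=.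
    have [xe|xe] := boolP (x \in e); last first.
      have [y yY ->] := eY e eE xe; apply/orP; right; apply/orP; left.
      apply/hasP; exists y; first exact: Yys.
      by apply/eqP/setP => v; rewrite !inE mem_rcons inE mem_enum.
    have [dX|/pred0Pn[v /andP[/= ve vX]]] := boolP [disjoint e & X].
      have /andP[cys ysE] := hys e eE xe dX; apply/orP; right; apply/orP; right.
      rewrite cys /=; apply/subsetP => v; rewrite !inE.
      by case/orP => [/eqP->//|vys]; apply: (subsetP ysE); rewrite inE.
    apply/orP; left; apply/hasP; exists v; first by rewrite mem_enum.
    by rewrite subUset !sub1set xe.
have memY v : v \in Y -> (v \notin X) && (v != x).
  by rewrite inE => /and4P[_ -> ->].
have [cY|cY] := leqP #|Y| (r - 1).
  have [] := finish (enum Y); rewrite ?enum_uniq //.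
  - by move=> v; rewrite mem_enum inE => /andP[].
  - by move=> v; rewrite mem_enum; apply: memY.
  - by move=> v; rewrite mem_enum.
  - move=> e eE xe dX; rewrite -cardE Y0 cY /=; apply/subsetP => v.
    by rewrite inE mem_enum; apply/subsetP/xY.
  - by move=> *; exists xs, (enum Y); split=> //; left; rewrite -cardE Y0 cY.
have cx : #|x |: X| = r by rewrite cardsU1 xX cX; lia.
have sxW : x |: X \subset W by rewrite subUset sub1set xW.
(* Here [Y] has at least r elements, so no edge contains both x and [Y], and every edge through x
   meets X. All vertices outside [x |: X] can then serve as the y_j, which is the case t = m - r. *)
have [] := finish (enum (W :\: (x |: X))); rewrite ?enum_uniq //.
- by move=> v; rewrite mem_enum inE => /andP[].
- by move=> v; rewrite mem_enum !inE negb_or => /andP[/andP[-> ->]].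
- move=> v vY; have /andP[vX vx] := memY v vY; rewrite mem_enum !inE negb_or vX vx.
  by move: vY; rewrite inE => /andP[->].
- move=> e eE xe dX; have sY := xY e eE xe dX.
  have : x |: Y \subset e by rewrite subUset sub1set xe.
  move/subset_leq_card; rewrite (edge_card eE) cardsU1.
  have -> : x \notin Y by apply/negP => /memY; rewrite eqxx andbF.
  by clear -cY; lia.
move=> *; exists xs, (enum (W :\: (x |: X))); split=> //.
by right; rewrite -cardE cardsD (setIidPr sxW) cx.
Qed.

(** * Stars with r - 2 leaves *)

Section Star.
Variables (x : T) (X : {set T}).
Hypotheses (xW : x \in W) (XW : X \subset W) (xX : x \notin X) (cX : #|X| = r - 2).
Hypothesis hX : forall e, e \in E -> x \notin e -> X \subset e.

(** The sets [e :\: X] with e in [Emiss] have two elements and are the edges of a graph G. As E is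
    intersecting, each member of [Eonly] is a vertex cover of G. *)
Definition Emiss := [set e in E | x \notin e].
Definition Eonly := [set e in E | (x \in e) && [disjoint e & X]].

(** The edges that contain x and meet X belong to every [HM''] with centre x and leaves X. The right
    choice of y's is immaterial: the r-sets whose trace on the special vertices is x with one of y1,
    z1 and one of y2, z2 are 4 C(m-(r+3), r-3) further edges of [HM''], and the remaining edges of E
    must outnumber them. *)
Lemma star_count : 4 * 'C(m - (r + 3), r - 3) < #|Eonly| + #|Emiss|.
Proof.
rewrite ltnNge; apply/negP => hle.
pose xs := enum X; have szx : size xs = r - 2 by rewrite -cardE.
have ux : uniq (x :: xs) by rewrite /= mem_enum xX enum_uniq.
have [|ys [sys uys ysW]] := @fresh T W (x :: xs) 4 _ ux.
  by rewrite /= szx; move: hm; clear -r4; lia.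
case: ys sys uys ysW => [|y1 [|z1 [|y2 [|z2 []]]]] //= _ uD ysW.
set K := HM'' W r x xs y1 z1 y2 z2.
have sD : {subset x :: xs ++ [:: y1; z1; y2; z2] <= W}.
  move=> v; rewrite inE mem_cat mem_enum => /or3P[/eqP->//|/(subsetP XW)//|/ysW//].
have cK : #|K| = hm'' m r by apply: card_HM'' => //; clear -r4; lia.
have U : uniq [:: x; y1; z1; y2; z2].
  apply: (@subseq_uniq _ _ (x :: xs ++ [:: y1; z1; y2; z2])) uD.
  by rewrite /= eqxx suffix_subseq.
have DW : [set v in x :: xs ++ [:: y1; z1; y2; z2]] \subset W.
  by apply/subsetP => v; rewrite inE => /sD.
have uX v : v \in [:: x; y1; z1; y2; z2] -> v \notin X.
  rewrite inE => /predU1P[->//|vy]; apply/negP => vX.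
  move: uD => /=; rewrite cat_uniq => /and4P[_ _ /hasPn/(_ v vy) + _].
  by rewrite /= mem_enum vX.
pose Q := setX [set y1; z1] [set y2; z2].
pose AA := [set [set x; u.1; u.2] | u in Q].
pose A := [set e in rsets W r | (x \in e) && ~~ [disjoint e & X]].
pose S := [set e in rsets W r | e :&: [set v in x :: xs ++ [:: y1; z1; y2; z2]] \in AA].
have cQ : #|Q| = 4.
  rewrite cardsX !cards2; move: U; rewrite /= !inE.
  by case: (y1 =P z1) => [->|_]; case: (y2 =P z2) => [->|_] //=; rewrite ?eqxx ?orbT ?andbF.
have Q3 u : u \in Q -> uniq [:: x; u.1; u.2].
  rewrite inE => /andP[/set2P h1 /set2P h2]; apply: subseq_uniq U.
  by case: h1 => ->; case: h2 => ->; rewrite /= !eqxx; do !case: eqP => //.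
have cAA : #|AA| = 4.
  rewrite -cQ card_in_imset // => u v uQ vQ euv.
  move: (uQ) (vQ); rewrite [u \in Q]inE [v \in Q]inE => /andP[u1 u2] /andP[v1 v2].
  have := Q3 u uQ; rewrite /= !inE negb_or !andbT => /andP[/andP[xu1 xu2] _].
  have d12 w w' : w \in [set y1; z1] -> w' \in [set y2; z2] -> w != w'.
    move=> /set2P h1 /set2P h2; apply/eqP => ww; move: U.
    by case: h1 h2 ww => -> [] -> ->; rewrite /= !inE !eqxx ?orbT ?andbF.
  have : u.1 \in [set x; v.1; v.2] by rewrite -euv !inE eqxx orbT.
  have : u.2 \in [set x; v.1; v.2] by rewrite -euv !inE eqxx orbT.
  rewrite !inE ![_ == x]eq_sym (negPf xu1) (negPf xu2) (negPf (d12 _ _ u1 v2)) /=.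
  rewrite [u.2 == v.1]eq_sym (negPf (d12 _ _ v1 u2)) orbF /= => /eqP e2 /eqP e1.
  by rewrite [u]surjective_pairing [v]surjective_pairing e1 e2.
have cS : #|S| = 4 * 'C(m - (r + 3), r - 3).
  have r3 : 3 <= r by clear -r4; lia.
  rewrite /S (@card_traces _ _ _ _ _ 3) //.
    rewrite cAA card_set_seq // /= size_cat /= szx.
    by congr (_ * 'C(_ - _, _)); clear -r4; lia.
  move=> B /imsetP[u uQ ->]; split; last first.
    rewrite -[RHS]/(size [:: x; u.1; u.2]) -card_set_seq ?Q3 //.
    by apply: eq_card => i; rewrite !inE orbA.
  move: uQ; rewrite inE => /andP[/set2P h1 /set2P h2].
  by rewrite !subUset !sub1set !inE !mem_cat !inE;
     case: h1 => ->; case: h2 => ->; rewrite !eqxx ?orbT.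
have AK : A \subset K.
  apply/subsetP => e; rewrite inE => /and3P[er xe /pred0Pn[v /andP[/= ve vX]]].
  by apply: (HM''_pair _ _ _ _ er xe _ ve); rewrite mem_enum.
have SF e : e \in S -> [/\ e \in rsets W r, x \in e,
    (y1 \in e) || (z1 \in e), (y2 \in e) || (z2 \in e) & [disjoint e & X]].
  rewrite inE => /andP[er /imsetP[u uQ eu]].
  have h v : v \in [:: x; y1; z1; y2; z2] -> (v \in e) = (v \in [set x; u.1; u.2]).
    move=> hv; rewrite -eu in_setI [v \in [set _ in _]]inE -cat_cons mem_cat.
    have -> : (v \in x :: xs) || (v \in [:: y1; z1; y2; z2]).
      by move: hv; rewrite !inE; case/orP => ->; rewrite ?orbT.
    by rewrite andbT.
  have [u1 u2] : u.1 \in [set y1; z1] /\ u.2 \in [set y2; z2].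
    by move: uQ; rewrite inE => /andP[].
  split=> //.
  - by rewrite h !inE eqxx.
  - by rewrite !h !inE ?eqxx ?orbT //; case/set2P: u1 => ->; rewrite eqxx ?orbT.
  - by rewrite !h !inE ?eqxx ?orbT //; case/set2P: u2 => ->; rewrite eqxx ?orbT.
  - rewrite disjoints_subset; apply/subsetP => v ve; rewrite inE; apply/negP => vX.
    have : v \in [set x; u.1; u.2].
      by rewrite -eu in_setI ve [v \in _]inE inE mem_cat mem_enum vX orbT.
    rewrite !inE => /orP[/orP[]|] /eqP vv; move: vX; rewrite vv; apply/negP.
    + exact: xX.
    + by apply: uX; case/set2P: u1 => ->; rewrite !inE eqxx ?orbT.
    + by apply: uX; case/set2P: u2 => ->; rewrite !inE eqxx ?orbT.
have SK : S \subset K.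
  by apply/subsetP => e /SF[er xe h1 h2 _]; apply: HM''_trans.
have dAS : A :&: S = set0.
  apply/setP => e; rewrite in_setI in_set0; apply/negP => /andP[].
  by rewrite inE => /and3P[_ _ nd] /SF[_ _ _ _]; apply/negP.
have hAS : #|A| + #|S| <= #|K|.
  have := cardsUI A S; rewrite dAS cards0 addn0 => <-.
  by apply: subset_leq_card; rewrite subUset AK.
have hEA : #|E| <= #|A| + (#|Eonly| + #|Emiss|).
  apply: (@leq_trans #|A :|: (Eonly :|: Emiss)|); last first.
    apply: leq_trans (leq_card_setU _ _) _; rewrite leq_add2l.
    exact: leq_card_setU.
  apply/subset_leq_card/subsetP => e eE; rewrite !in_setU.
  rewrite [e \in A]inE [e \in Eonly]inE [e \in Emiss]inE eE (subsetP sE _ eE) /=.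
  by case: (x \in e); case: [disjoint e & X].
by move: hE hEA hAS hle; rewrite cK cS -/m; clear; lia.
Qed.

Local Notation C3 := ('C(m, r - 3)).
Local Notation C4 := ('C(m, r - 4)).
Local Notation F a b := [set e in Eonly | [set x; a; b] \subset e].

Lemma Eonly_sub : Eonly \subset rsets W r.
Proof. by apply: subset_trans sE; apply/subsetP => e; rewrite inE => /andP[]. Qed.

Lemma Emiss_sub : Emiss \subset rsets W r.
Proof. by apply: subset_trans sE; apply/subsetP => e; rewrite inE => /andP[]. Qed.

Lemma EmissP e : e \in Emiss -> [/\ e \in E, x \notin e & X \subset e].
Proof. by rewrite inE => /andP[eE xe]; split=> //; apply: hX. Qed.

Lemma Emiss_pairE e : e \in Emiss -> exists p q,
  [/\ p != q, p \notin X, q \notin X & e = [set p; q] :|: X].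
Proof.
move=> /EmissP[eE xe sX]; have ce := edge_card eE.
have /eqP/cards2P[p [q [pq epq]]] : #|e :\: X| = 2.
  by rewrite cardsD (setIidPr sX) cX ce; clear -r4; lia.
exists p, q; split=> //.
- by have : p \in e :\: X; [rewrite epq !inE eqxx|rewrite inE => /andP[]].
- by have : q \in e :\: X; [rewrite epq !inE eqxx orbT|rewrite inE => /andP[]].
- by rewrite -epq setUC -{1}(setIidPr sX) setID.
Qed.

Lemma notX_neqx e a : e \in Emiss -> a \in e -> a != x.
Proof. by move=> /EmissP[_ xe _] ae; apply: contraNneq xe => <-. Qed.

Lemma card_xab (a b : T) : uniq [:: x; a; b] -> #|[set x; a; b]| = 3.
Proof.
move=> h; rewrite -[RHS]/(size [:: x; a; b]) -card_set_seq //.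
by apply: eq_card => i; rewrite !inE orbA.
Qed.

Lemma Eonly_pair a b : uniq [:: x; a; b] -> #|F a b| <= C3.
Proof. by move=> h; have := card_sup [set x; a; b] Eonly_sub; rewrite card_xab. Qed.

(** The members counted must meet e in one of its two vertices outside X, and both differ from x, a
    and b. *)
Lemma Eonly_pair_miss a b e : uniq [:: x; a; b] -> e \in Emiss ->
  a \notin e -> b \notin e -> #|F a b| <= 2 * C4.
Proof.
move=> h eM ae be; have [eE xe sX] := EmissP eM.
have c2 : #|e :\: X| = 2.
  by rewrite cardsD (setIidPr sX) cX (edge_card eE); clear -r4; lia.
have := @card_sup_meet T W [set x; a; b] (e :\: X) r Eonly Eonly_sub.
rewrite c2 card_xab //; apply.
  rewrite disjoints_subset !subUset !sub1set !inE.
  by rewrite (negPf ae) (negPf be) (negPf xe) !andbF.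
move=> f; rewrite inE => /and3P[fE _ dfX] _.
have /pred0Pn[v /andP[/= vf ve]] := hI fE eE.
by apply/pred0Pn; exists v; rewrite /= vf inE ve (disjointFr dfX vf).
Qed.

(** X, a and one further vertex determine an edge. With [Emiss_two] this bounds the degrees and the
    multiplicities in G. *)
Lemma Emiss_pt a : a \notin X -> #|[set e in Emiss | a \in e]| <= m.
Proof.
move=> aX; have := card_sup (a |: X) Emiss_sub.
rewrite cardsU1 aX cX; have -> : r - (true + (r - 2)) = 1 by clear -r4; lia.
rewrite bin1 => h; apply: leq_trans h; apply/subset_leq_card/subsetP => e.
rewrite !inE => /andP[eM ae]; rewrite eM subUset sub1set ae.
by have [] := @EmissP e; rewrite ?inE.
Qed.

Lemma Emiss_two a b : a != b -> a \notin X -> b \notin X ->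
  #|[set e in Emiss | (a \in e) && (b \in e)]| <= 1.
Proof.
move=> ab aX bX; have := card_sup (a |: (b |: X)) Emiss_sub.
rewrite !cardsU1 !inE negb_or ab aX bX cX.
have -> : r - (true && true + (true + (r - 2))) = 0 by clear -r4; rewrite /=; lia.
rewrite bin0 => h; apply: leq_trans h; apply/subset_leq_card/subsetP => e.
rewrite !inE => /and3P[eM ae be]; rewrite eM !subUset !sub1set ae be.
by have [] := @EmissP e; rewrite ?inE.
Qed.

(** The main term 3 C3 is below the 4 C3 of [star_count]. The allowance 8 C4 + 4 holds the
    lower-order terms of all the cases below: four pairs with 2 C4 each, and up to four edges of
    G. *)
Lemma star_count_contra : #|Eonly| + #|Emiss| <= 3 * C3 + (8 * C4 + 4) -> False.
Proof.
move=> hle; have := star_count.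
have e3 : (r - 4).+1 = r - 3 by clear -r4; lia.
have := @bin_drop m (r + 3) (r - 4); have := @grow (r - 4).
rewrite e3 -/m => /(_ ltac:(clear -r4; lia)) h1 h2 h3.
have c0 : 0 < C4 by rewrite bin_gt0; move: hm; rewrite -/m; clear -r4; lia.
(* The term 4 (r + 3) is the loss in replacing m - (r + 3) by m, and 12 is 8 + 4, since 1 <= C4. *)
have h4 : (4 * (r + 3) + 12) * C4 <= 20 * (r * r * r) * C4.
  by rewrite leq_mul2r; apply/orP; right; clear -r4; nia.
move: h4; rewrite mulnDl -[4 * _ * _]mulnA => h4.
by move: hle h1 h2 h3 h4 c0; clear; lia.
Qed.

Lemma m_le_C3 : m <= C3.
Proof.
rewrite -{1}(bin1 m); apply: bin_mono; first by clear -r4; lia.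
by move: hm; rewrite -/m; clear; lia.
Qed.

Lemma Eonly_meet e f : e \in Eonly -> f \in Emiss ->
  exists2 v, v \in e & v \in f :\: X.
Proof.
rewrite inE => /and3P[eE _ dX] /EmissP[fE _ _].
have /pred0Pn[v /andP[/= ve vf]] := hI eE fE.
by exists v => //; rewrite inE vf (disjointFr dX ve).
Qed.

Lemma Eonly_meet2 e p q : e \in Eonly -> [set p; q] :|: X \in Emiss ->
  (p \in e) || (q \in e).
Proof.
move=> eO /(Eonly_meet eO)[v ve]; rewrite !inE => /andP[vX].
by rewrite (negPf vX) orbF => /orP[]/eqP<-; rewrite ve ?orbT.
Qed.

Lemma Eonly_cover (e : {set T}) a b : e \in Eonly -> a \in e -> b \in e -> e \in F a b.
Proof.
move=> eO ae be; rewrite inE eO !subUset !sub1set ae be.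
by move: eO; rewrite inE => /and3P[_ ->].
Qed.

(** Pairwise intersecting edges of G without a common vertex form a triangle. Its vertex covers
    contain two of its three vertices, so [Eonly] has at most 3 C3 members and [Emiss] at most 3. *)
Lemma triangle_contra :
  (forall v, v \notin X -> exists2 e, e \in Emiss & v \notin e) ->
  (forall e f, e \in Emiss -> f \in Emiss -> ~~ [disjoint e :\: X & f]) -> False.
Proof.
move=> hns hdis; have [e0 e0E xe0] := htau x.
have e0M : e0 \in Emiss by rewrite inE e0E.
have meet p q f : [set p; q] :|: X \in Emiss -> f \in Emiss -> (p \in f) || (q \in f).
  move=> h fM; have /pred0Pn[v /andP[/= + vf]] := hdis _ _ h fM.
  by rewrite !inE => /andP[/negPf->]; rewrite orbF => /orP[]/eqP<-; rewrite vf ?orbT.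
have [p [q [pq pX qX ee]]] := Emiss_pairE e0M; rewrite {}ee in e0M.
(* An edge of G missing p has the form qk, and one missing q must then be pk. *)
have [f fM pf] := hns p pX.
have qf : q \in f by have := meet _ _ _ e0M fM; rewrite (negPf pf).
have [k [kq kX ef]] : exists k, [/\ k != q, k \notin X & f = [set q; k] :|: X].
  have [u [v [uv uX vX ef]]] := Emiss_pairE fM.
  move: qf; rewrite ef !inE (negPf qX) orbF => /orP[]/eqP->.
    by exists v; rewrite eq_sym uv.
  by exists u; rewrite uv [in RHS]setUC [[set v; u]]setUC [RHS]setUC.
have kf : k \in f by rewrite ef !inE eqxx orbT.
have pk : p != k by apply: contraNneq pf => ->.
rewrite ef in fM.
have [h hM qh] := hns q qX.
have ph : p \in h by have := meet _ _ _ e0M hM; rewrite (negPf qh) orbF.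
have kh : k \in h by have := meet _ _ _ fM hM; rewrite (negPf qh).
have eh : [set p; k] :|: X = h.
  have [hhE _ sXh] := EmissP hM.
  apply/eqP; rewrite eqEcard !subUset !sub1set ph kh sXh (edge_card hhE) /=.
  rewrite cardsU cards2 pk cX; have -> : [set p; k] :&: X = set0.
    apply/setP => v; rewrite !inE; by apply/negP => /andP[/orP[]/eqP->]; rewrite ?(negPf pX) ?(negPf kX).
  by rewrite cards0; clear -r4; lia.
rewrite -eh in hM.
have neqx v : v \in [:: p; q; k] -> x != v.
  by rewrite eq_sym !inE => /or3P[]/eqP->; [apply: (notX_neqx e0M)|apply: (notX_neqx e0M)|apply: (notX_neqx fM)];
     rewrite !inE eqxx ?orbT.
have u3 a b : a \in [:: p; q; k] -> b \in [:: p; q; k] -> a != b -> uniq [:: x; a; b].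
  by move=> ha hb ab; rewrite /= !inE negb_or !neqx // ab.
apply: star_count_contra; rewrite leq_add //.
  have s : Eonly \subset F p q :|: (F q k :|: F p k).
    apply/subsetP => e eO.
    have h1 := Eonly_meet2 eO e0M; have h2 := Eonly_meet2 eO fM.
    have h3 := Eonly_meet2 eO hM; rewrite !in_setU.
    have [pe|pe] := boolP (p \in e).
      have [qe|qe] := boolP (q \in e); first by rewrite Eonly_cover.
      by rewrite (@Eonly_cover e p k eO pe) ?orbT //; move: h2; rewrite (negPf qe).
    rewrite (negPf pe) /= in h1 h3.
    by rewrite (Eonly_cover eO h1 h3) orbT.
  apply: leq_trans (subset_leq_card s) _; apply: leq_trans (leq_card_setU _ _) _.
  rewrite mulSn leq_add ?Eonly_pair ?u3 ?inE ?eqxx ?orbT //.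
  apply: leq_trans (leq_card_setU _ _) _.
  by rewrite mul2n -addnn leq_add ?Eonly_pair ?u3 ?inE ?eqxx ?orbT // eq_sym.
pose N a b := [set e in Emiss | (a \in e) && (b \in e)].
have s : Emiss \subset N p q :|: (N q k :|: N p k).
  apply/subsetP => e eM.
  have := meet _ _ _ e0M eM; have := meet _ _ _ fM eM; have := meet _ _ _ hM eM.
  rewrite !in_setU [e \in N p q]inE [e \in N q k]inE [e \in N p k]inE eM.
  by case: (p \in e); case: (q \in e); case: (k \in e).
apply: leq_trans (leq_trans (subset_leq_card s) (leq_card_setU _ _)) _.
apply: (@leq_trans (1 + (1 + 1))); last by clear; lia.
rewrite leq_add ?Emiss_two //; apply: leq_trans (leq_card_setU _ _) _.
by rewrite leq_add ?Emiss_two // eq_sym.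
Qed.

(* For r = 4 the hypothesis excludes the subfamilies of HM0, where Emiss can have
   'C(m, 2) elements, up to lower order. *)
Lemma Emiss_le : 5 <= r \/ Eonly != set0 -> #|Emiss| <= 3 * C3.
Proof.
have hmC := m_le_C3.
have [r5 _|r5 h] := leqP 5 r.
  have := card_sup X Emiss_sub; rewrite cX.
  have -> : r - (r - 2) = 2 by clear -r4; lia.
  have -> : [set e in Emiss | X \subset e] = Emiss.
    apply/setP => e; rewrite inE; case: (boolP (e \in Emiss)) => //= eM.
    by have [] := EmissP eM.
  move=> h; apply: leq_trans h _; apply: (@leq_trans C3); last by rewrite leq_pmull.
  by apply: bin_mono; [clear -r5; lia | move: hm; rewrite -/m; clear; lia].
have r4e : r = 4 by move: r4 r5; clear; lia.
case: h => [h|/set0Pn[g gO]]; first by move: h r5; clear; lia.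
move: (gO); rewrite inE => /and3P[gE xg dX].
have cg : #|g :\ x| = 3.
  by have := cardsD1 x g; rewrite xg (edge_card gE) {1}r4e => -[].
apply: (@leq_trans (\sum_(v in g :\ x) #|[set e in Emiss | v \in e]|)).
  apply: leq_trans (card_bigcup_le _ _); apply/subset_leq_card/subsetP => e eM.
  have [v vg] := Eonly_meet gO eM; rewrite inE => /andP[vX ve].
  apply/bigcupP; exists v; last by rewrite inE eM.
  by rewrite !inE vg (notX_neqx eM ve).
have <- : \sum_(v in g :\ x) C3 = 3 * C3 by rewrite sum_nat_const cg.
apply: leq_sum => v; rewrite !inE => /andP[vx vg].
by apply: leq_trans hmC; apply: Emiss_pt; rewrite (disjointFr dX).
Qed.

(** For a and b outside X this says that {a, b} is a vertex cover of G. It will be asked of the four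
    pairs that join two disjoint edges of G. *)
Definition cov a b := [forall g in Emiss, (a \in g) || (b \in g)].

Lemma covP a b g : cov a b -> g \in Emiss -> (a \in g) || (b \in g).
Proof. by move=> /forallP/(_ g)/implyP; apply. Qed.

Lemma cov_le a b : a \notin X -> b \notin X -> cov a b -> #|Emiss| <= m + m.
Proof.
move=> aX bX h.
have s : Emiss \subset [set g in Emiss | a \in g] :|: [set g in Emiss | b \in g].
  apply/subsetP => g gM; have := covP h gM.
  by move: gM; rewrite in_setU !in_set => ->.
apply: leq_trans (leq_trans (subset_leq_card s) (leq_card_setU _ _)) _.
by rewrite leq_add // Emiss_pt.
Qed.

(** An edge of G that misses a can only be bc. *)
Lemma cov_adj_le a b c : a \notin X -> b \notin X -> c \notin X -> b != c ->
  cov a b -> cov a c -> #|Emiss| <= m + 1.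
Proof.
move=> aX bX cX' bc h1 h2.
have s : Emiss \subset [set g in Emiss | a \in g] :|:
    [set g in Emiss | (b \in g) && (c \in g)].
  apply/subsetP => g gM; have := covP h1 gM; have := covP h2 gM.
  by move: gM; rewrite in_setU !in_set => ->; case: (a \in g) => //= -> ->.
apply: leq_trans (leq_trans (subset_leq_card s) (leq_card_setU _ _)) _.
by rewrite leq_add ?Emiss_pt ?Emiss_two.
Qed.

(** Every edge of G has one end in {a, b} and the other in {c, d}. *)
Lemma cov_opp_le a b c d : a \notin X -> b \notin X -> c \notin X -> d \notin X ->
  a != c -> a != d -> b != c -> b != d ->
  cov a b -> cov c d -> #|Emiss| <= 4.
Proof.
move=> aX bX cX' dX ac ad bc bd h1 h2.
pose N u v := [set g in Emiss | (u \in g) && (v \in g)].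
have s : Emiss \subset N a c :|: (N a d :|: (N b c :|: N b d)).
  apply/subsetP => g gM; have := covP h1 gM; have := covP h2 gM.
  by move: gM; rewrite !in_setU /N !in_set => ->;
     case: (a \in g); case: (b \in g); case: (c \in g); case: (d \in g).
apply: leq_trans (subset_leq_card s) _.
apply: (@leq_trans (1 + (1 + (1 + 1)))) => //.
do 3![apply: leq_trans (leq_card_setU _ _) _; rewrite leq_add ?Emiss_two //].
Qed.

(** An edge of G that misses p or q contains p' and q'. So G consists of pq and p'q' alone, and E
    lies in a copy of [HM''], against its size. *)
Lemma HM''_contra p q p' q' : uniq [:: p; q; p'; q'] ->
  {in [:: p; q; p'; q'], forall v, [/\ v \in W, v != x & v \notin X]} ->
  [set p; q] :|: X \in Emiss -> [set p'; q'] :|: X \in Emiss ->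
  [/\ cov p p', cov p q', cov q p' & cov q q'] -> False.
Proof.
move=> U hv eM fM [c1 c2 c3 c4].
pose xs := enum X; have szx : size xs = r - 2 by rewrite -cardE.
have uD : uniq (x :: xs ++ [:: p; q; p'; q']).
  rewrite cons_uniq cat_uniq enum_uniq U andbT mem_cat mem_enum negb_or xX !andTb.
  apply/andP; split; first by apply/negP => /hv[]; rewrite eqxx.
  by apply/hasPn => v /hv[]; rewrite /= mem_enum.
have sD : {subset x :: xs ++ [:: p; q; p'; q'] <= W}.
  by move=> v; rewrite inE mem_cat mem_enum => /or3P[/eqP->//|/(subsetP XW)//|/hv[]].
have cK := @card_HM'' T W r x xs p q p' q' _ szx uD sD.
suff /subset_leq_card : E \subset HM'' W r x xs p q p' q'.
  by rewrite cK; [rewrite leqNgt hE | clear -r4; lia].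
apply/subsetP => g gE; have gr := subsetP sE _ gE.
have [xg|xg] := boolP (x \in g).
  have [dX|/pred0Pn[v /andP[/= vg vX]]] := boolP [disjoint g & X]; last first.
    by apply: (HM''_pair _ _ _ _ gr xg _ vg); rewrite mem_enum.
  have gO : g \in Eonly by rewrite inE gE xg.
  by apply: HM''_trans => //; [apply: Eonly_meet2 eM|apply: Eonly_meet2 fM].
have gM : g \in Emiss by rewrite inE gE.
have [_ _ sX] := EmissP gM.
have eqg u v : u != v -> u \notin X -> v \notin X -> u \in g -> v \in g ->
    g = [set w in xs ++ [:: u; v]].
  move=> uv uX vX ug vg; apply/esym/eqP; rewrite eqEcard card_set_seq; last first.
    rewrite cat_uniq enum_uniq /= !inE uv !mem_enum.
    by rewrite (negPf uX) (negPf vX).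
  rewrite size_cat szx (edge_card gE) /=; apply/andP; split; last by clear -r4; lia.
  apply/subsetP => w; rewrite !inE mem_cat mem_enum !inE.
  by case/or3P => [/(subsetP sX)|/eqP->|/eqP->].
have /orP[/andP[pg qg]|/andP[pg qg]] : (p \in g) && (q \in g) || (p' \in g) && (q' \in g).
  have := covP c1 gM; have := covP c2 gM; have := covP c3 gM; have := covP c4 gM.
  by case: (p \in g); case: (q \in g); case: (p' \in g); case: (q' \in g).
- rewrite inE gr (eqg p q) ?eqxx ?orbT //.
  + by move: U; rewrite /= !inE; case: (p == q).
  + by have [] := hv p; rewrite ?inE ?eqxx.
  + by have [] := hv q; rewrite ?inE ?eqxx ?orbT.
- rewrite inE gr (eqg p' q') ?eqxx ?orbT //.
  + by move: U; rewrite /= !inE; case: (p' == q'); rewrite ?andbF.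
  + by have [] := hv p'; rewrite ?inE ?eqxx ?orbT.
  + by have [] := hv q'; rewrite ?inE ?eqxx ?orbT.
Qed.

(** Let pq and p'q' be disjoint edges of G. A member of [Eonly] contains one of the four pairs
    joining them. A joining pair lies in up to C3 members if it covers G and in at most 2 C4
    otherwise; but the more of these pairs cover G, the fewer edges G has. *)
Lemma disjoint_contra e f : e \in Emiss -> f \in Emiss -> [disjoint e :\: X & f] ->
  5 <= r \/ Eonly != set0 -> False.
Proof.
move=> eM fM def hr.
have [p [q [pq pX qX ee]]] := Emiss_pairE eM.
have [p' [q' [pq' pX' qX' ef]]] := Emiss_pairE fM.
have [pe qe] : p \in e /\ q \in e by rewrite ee !inE !eqxx orbT.
have [pf' qf'] : p' \in f /\ q' \in f by rewrite ef !inE !eqxx orbT.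
have ne v : v \in e -> v \notin X -> v \notin f.
  by move=> ve vX; rewrite (disjointFr def) // inE vX.
have ne' v : v \in f -> v \notin X -> v \notin e.
  by move=> vf vX; apply/negP => ve; have := ne v ve vX; rewrite vf.
have neq u v : u \in e -> u \notin X -> v \in f -> u != v.
  by move=> ue uX vf; apply: contraNneq (ne u ue uX) => ->.
have hv : {in [:: p; q; p'; q'], forall v, [/\ v \in W, v != x & v \notin X]}.
  have eW := edge_sub (let: And3 h _ _ := EmissP eM in h).
  have fW := edge_sub (let: And3 h _ _ := EmissP fM in h).
  move=> v; rewrite !inE => /or4P[]/eqP->; split=> //;
    by [apply: (subsetP eW)|apply: (subsetP fW)|apply: (notX_neqx eM)|apply: (notX_neqx fM)].
have U : uniq [:: p; q; p'; q'].
  by rewrite /= !inE !negb_or pq pq' !neq.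
have bnd a b : a \in e -> a \notin X -> b \in f -> b \notin X ->
    #|F a b| <= if cov a b then C3 else 2 * C4.
  move=> ae aX bf bX.
  have uab : uniq [:: x; a; b].
    rewrite /= !inE negb_or (neq a b) // !andbT [x == a]eq_sym [x == b]eq_sym.
    by rewrite (notX_neqx eM) // (notX_neqx fM).
  case: ifP => [_|/negbT]; first exact: Eonly_pair.
  rewrite negb_forall => /existsP[g]; rewrite negb_imply negb_or => /and3P[gM ag bg].
  exact: Eonly_pair_miss gM ag bg.
have sO : Eonly \subset F p p' :|: (F p q' :|: (F q p' :|: F q q')).
  rewrite ee in eM; rewrite ef in fM; apply/subsetP => g gO; rewrite !in_setU.
  have /orP[pg|pg] := Eonly_meet2 gO eM; have /orP[pg'|pg'] := Eonly_meet2 gO fM;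
    by rewrite (Eonly_cover gO pg pg') ?orbT.
have hO : #|Eonly| <= (if cov p p' then C3 else 2 * C4) + ((if cov p q' then C3 else 2 * C4)
    + ((if cov q p' then C3 else 2 * C4) + (if cov q q' then C3 else 2 * C4))).
  apply: leq_trans (subset_leq_card sO) _.
  do 3![apply: leq_trans (leq_card_setU _ _) _; rewrite leq_add ?bnd //].
have hall : ~ [/\ cov p p', cov p q', cov q p' & cov q q'].
  by rewrite ee in eM; rewrite ef in fM; apply: HM''_contra.
have sym a b : cov a b = cov b a by apply: eq_forallb => g; rewrite orbC.
have h0 := Emiss_le hr.
have [h1 h2 h3 h4] := And4 (cov_le pX pX') (cov_le pX qX') (cov_le qX pX') (cov_le qX qX').
have h12 := cov_adj_le pX pX' qX' pq'.
have h34 := cov_adj_le qX pX' qX' pq'.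
have h13 := cov_adj_le pX' pX qX pq; rewrite ![cov p' _]sym in h13.
have h24 := cov_adj_le qX' pX qX pq; rewrite ![cov q' _]sym in h24.
have npp' := neq _ _ pe pX pf'; have npq' := neq _ _ pe pX qf'.
have nqp' : p' != q by rewrite eq_sym neq.
have nqq' : q' != q by rewrite eq_sym neq.
have h14 := cov_opp_le pX pX' qX qX' pq npq' nqp' pq'.
have h23 := cov_opp_le pX qX' qX pX' pq npp' nqq' _; rewrite eq_sym in h23.
have {}h23 := h23 pq'.
have hmC := m_le_C3; apply: star_count_contra.
move: hO hall h0 h1 h2 h3 h4 h12 h34 h13 h24 h14 h23 hmC.
move: #|Eonly| #|Emiss| (C3) (C4) m => o z c3 c4 mm.
(* The bounds on [Eonly] and [Emiss], by the number of joining pairs that cover G, are: none, 8 C4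
   and 3 C3; one, C3 + 6 C4 and 2 m; two, 2 C3 + 4 C4 and m + 1 or 4; three, 3 C3 + 2 C4 and 4. As m
   <= C3, each sum is within 3 C3 + 8 C4 + 4. Four covering pairs are excluded by [hall]. *)
clear; case: (cov p p'); case: (cov p q'); case: (cov q p'); case: (cov q q') => /=.
  by move=> _ [].
all: by lia.
Qed.
End Star.

Lemma intersecting_structure :
  (exists x xs ys, [/\ size xs = r - 1, uniq (x :: xs ++ ys),
    {subset x :: xs ++ ys <= W}, 1 <= size ys <= r - 1 \/ size ys = m - r
    & E \subset HM W r x xs ys]) \/
  (r = 4 /\ exists x x1 x2, [/\ uniq [:: x; x1; x2],
    {subset [:: x; x1; x2] <= W} & E \subset HM0 W r x x1 x2]).
Proof.
have HM0_of x x1 x2 : r = 4 -> uniq [:: x; x1; x2] -> [set x; x1; x2] \subset W ->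
    (forall e, e \in E -> 2 <= #|e :&: [set x; x1; x2]|) ->
    r = 4 /\ exists x x1 x2, [/\ uniq [:: x; x1; x2],
      {subset [:: x; x1; x2] <= W} & E \subset HM0 W r x x1 x2].
  move=> r4e u sW h; split=> //; exists x, x1, x2; split=> //.
    by move=> v hv; apply: (subsetP sW); move: hv; rewrite !inE orbA.
  by apply/subsetP => e eE; rewrite inE (subsetP sE _ eE) h.
have [[a [b [c [uabc sabc h2]]]]|[x [X [xW XW xX cX hX]]]] := triangle_or_star.
  have [r5|r5] := leqP 5 r; first by case: (no_triangle r5 uabc sabc h2).
  by right; apply: (HM0_of a b c) => //; clear -r4 r5; lia.
have [e0 e0E xe0] := htau x.
have e0M : e0 \in Emiss x by rewrite inE e0E.
have [/existsP[v /andP[vX /forallP hv]]|] :=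
    boolP [exists v, (v \notin X) && [forall e in Emiss x, v \in e]].
  (* A vertex common to all edges of G enlarges X to a set of r - 1 leaves. *)
  left; have hv' e : e \in Emiss x -> v \in e by apply/implyP.
  have vx : v != x by apply: contraNneq xe0 => <-; apply: hv'.
  have vW := subsetP (edge_sub e0E) _ (hv' _ e0M).
  have [|||e eE xe|xs [ys h]] := @star_HM x (v |: X) xW; last by exists x, xs, ys.
  - by rewrite subUset sub1set vW.
  - by rewrite !inE negb_or eq_sym vx.
  - by rewrite cardsU1 vX cX; clear -r4; lia.
  - by rewrite subUset sub1set hX // hv' // inE eE.
rewrite negb_exists => /forallP hns.
have {}hns v : v \notin X -> exists2 e, e \in Emiss x & v \notin e.
  move=> vX; have := hns v; rewrite vX /= negb_forall => /existsP[e].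
  by rewrite negb_imply => /andP[eM ve]; exists e.
have [/existsP[e /andP[eM /existsP[f /andP[fM def]]]]|] :=
    boolP [exists e in Emiss x, exists f in Emiss x, [disjoint e :\: X & f]]; last first.
  rewrite negb_exists => /forallP h; case: (@triangle_contra x X) => // e f eM fM.
  have := h e; rewrite eM /= negb_exists => /forallP/(_ f).
  by rewrite fM.
have [hr|] := boolP ((5 <= r) || (Eonly x X != set0)).
  by case: (@disjoint_contra x X xW XW xX cX hX e f eM fM def); apply/orP.
(* In the remaining case r = 4 and [Eonly] is empty: edges through x meet the two-element set X, and
   all other edges contain it. *)
rewrite negb_or negbK -ltnNge => /andP[r5 /eqP O0].
have r4e : r = 4 by clear -r4 r5; lia.
have /eqP/cards2P[x1 [x2 [x12 eX]]] : #|X| = 2 by rewrite cX r4e.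
right; apply: (HM0_of x x1 x2) => //.
- move: xX; rewrite eX !inE negb_or => /andP[h1 h2].
  by rewrite /= !inE negb_or h1 h2 x12.
- by move: XW; rewrite eX !subUset !sub1set xW => /andP[-> ->].
move=> g gE; have [xg|xg] := boolP (x \in g); last first.
  have sXg := hX g gE xg; have <- : #|X| = 2 by rewrite cX r4e.
  apply: subset_leq_card.
  by rewrite subsetI sXg eX; apply/subsetP => v; rewrite !inE => /orP[]->; rewrite ?orbT.
have : g \notin Eonly x X by rewrite O0 inE.
rewrite inE gE xg /= => /pred0Pn[v /andP[/= vg vX]].
have xv : x != v by apply: contraNneq xX => ->.
have <- : #|[set x; v]| = 2 by rewrite cards2 xv.
apply: subset_leq_card; rewrite subsetI !subUset !sub1set xg vg !inE eqxx /=.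
by move: vX; rewrite eX !inE => /orP[]->; rewrite ?orbT.
Qed.
End Core.

(** * Families of matching number s *)

Section BigMin.
Variables (I : finType) (P : pred I) (F : I -> nat) (d : nat).

Lemma bigmin_le i : P i -> \big[minn/d]_(j | P j) F j <= F i.
Proof.
move=> Pi; have := mem_index_enum i; elim: (index_enum I) => // j s IH.
rewrite inE big_cons => /predU1P[<-|/IH]; first by rewrite Pi geq_minl.
by case: ifP => // _; apply: leq_trans; apply: geq_minr.
Qed.

Lemma bigmin_attained : \big[minn/d]_(j | P j) F j = d \/
  exists2 i, P i & \big[minn/d]_(j | P j) F j = F i.
Proof.
elim/big_rec: _ => [|i y Pi IH]; first by left.
rewrite /minn; case: ifP => _ //.
by right; exists i.
Qed.
End BigMin.

Section Tau.
Variables (T : finType) (r : nat) (F : runiform T r).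

Lemma tau1 v e : v \in verts F -> e \in edges F ->
  (forall f, f \in edges F -> v \in f) -> tau F = 1.
Proof.
move=> vV eF hv; apply/eqP; rewrite eqn_leq; apply/andP; split.
  rewrite -(cards1 v); apply: (bigmin_le (fun S : {set T} => #|S|)).
  rewrite /is_cover sub1set vV; apply/forall_inP => f fF.
  by rewrite disjoint_sym disjoints1 negbK hv.
rewrite /tau; case: (bigmin_attained (is_cover F) (fun S : {set T} => #|S|) #|verts F|) => [->|[S]].
  by apply/card_gt0P; exists v.
rewrite /is_cover => /andP[_ /forall_inP/(_ e eF)] + ->.
by rewrite card_gt0; apply: contraNneq => ->; rewrite -setI_eq0 setI0.
Qed.

(** The bound on [verts F] separates the value 1 from the default value of the minimum, so that it
    is attained by an actual cover. *)
Lemma tau1_common : 1 < #|verts F| -> tau F = 1 ->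
  exists v, forall f, f \in edges F -> v \in f.
Proof.
move=> hV; rewrite /tau.
case: (bigmin_attained (is_cover F) (fun S : {set T} => #|S|) #|verts F|) => [->|[S]].
  by move=> hV1; rewrite hV1 in hV.
rewrite /is_cover => /andP[_ /forall_inP hS] -> /eqP/cards1P[v eS].
by exists v => f /hS; rewrite eS disjoint_sym disjoints1 negbK.
Qed.
End Tau.

(** * Matchings and vertices of large degree *)

Section Matching.
Variables (T : finType) (V : {set T}) (r : nat) (E : {set {set T}}).
Hypothesis r4 : 4 <= r.
Hypothesis sE : E \subset rsets V r.

Lemma card_meet (Z : {set T}) : Z \subset V ->
  #|[set e in rsets V r | ~~ [disjoint e & Z]]| = em #|V| r #|Z|.
Proof.
move=> sZ; have c : #|rsets (V :\: Z) r| = 'C(#|V| - #|Z|, r).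
  by rewrite card_rsets cardsD (setIidPr sZ).
have sub : rsets (V :\: Z) r \subset rsets V r.
  by apply/subsetP => e; rewrite !inE subsetD -andbA => /and3P[-> _ ->].
rewrite /em -c -(card_rsets V) -(setIidPr sub) -cardsD; apply: eq_card => e.
rewrite in_setD [e \in rsets (V :\: Z) r]inE subsetD.
rewrite [LHS]inE [e \in rsets V r]inE; case: (e \subset V) => //=.
by case: (#|e| == r); rewrite ?andbF ?andbT.
Qed.

Lemma card_edge e : e \in E -> #|e| = r.
Proof. by move=> /(subsetP sE); rewrite inE => /andP[_ /eqP]. Qed.

Lemma card_cover_matching (M : {set {set T}}) : M \subset E -> #|cover M| <= r * #|M|.
Proof.
move=> sM; apply: leq_trans (leq_card_cover M) _.
rewrite mulnC -sum_nat_const leq_sum // => e eM.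
by rewrite card_edge ?(subsetP sM).
Qed.

Lemma matchingU1 e (M : {set {set T}}) : e \in E -> M \subset E -> trivIset M ->
  [disjoint e & cover M] ->
  [/\ e |: M \subset E, trivIset (e |: M) & #|e |: M| = #|M|.+1].
Proof.
move=> eE sM tM dM.
have e0 f : f \in E -> f != set0 by move=> fE; rewrite -card_gt0 card_edge //; lia.
have M0 : set0 \notin M by apply/negP => /(subsetP sM)/e0; rewrite eqxx.
have hd f : f \in M -> [disjoint e & f].
  by move=> fM; apply: disjointWr dM; apply: bigcup_sup.
have [tU eM] := trivIsetU1 hd tM M0.
by rewrite subUset sub1set eE sM cardsU1 eM.
Qed.

(** For z in Z, the edge added must avoid the vertices of M and the rest of Z, a set [B] of at most
    r c vertices. At most r c C(n, r-2) edges through z meet [B], so the degree of z leaves one to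
    spare. *)
Lemma extend_matching c (Z : {set T}) (M : {set {set T}}) :
  (forall z, z \in Z ->
     r * c * 'C(#|V|, r - 2) < #|[set e in E | [set z] \subset e]|) ->
  M \subset E -> trivIset M -> [disjoint Z & cover M] -> #|M| + #|Z| <= c ->
  exists M' : {set {set T}}, [/\ M' \subset E, trivIset M' & #|M'| = #|M| + #|Z|].
Proof.
have [k] := ubnP #|Z|; elim: k Z M => // k IH Z M hk hZ sM tM dZM hc.
have [->|/set0Pn[z zZ]] := eqVneq Z set0; first by exists M; rewrite cards0 addn0.
pose B := cover M :|: Z :\ z.
have cZ : #|Z| = #|Z :\ z|.+1 by rewrite (cardsD1 z) zZ.
have cB : #|B| <= r * c.
  apply: leq_trans (leq_card_setU _ _) _.
  apply: (@leq_trans (r * #|M| + r * #|Z|)); last by rewrite -mulnDr leq_mul2l hc orbT.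
  rewrite leq_add ?card_cover_matching // cZ.
  by rewrite mulnS; apply: leq_trans (leq_addl _ _); rewrite leq_pmull //; lia.
have zB : [disjoint [set z] & B].
  by rewrite disjoints1 !inE eqxx orbF (disjointFr dZM zZ).
have [f fE [zf fB]] : exists2 f, f \in E & z \in f /\ [disjoint f & B].
  have [/exists_inP[f fE /andP[zf fB]]|] :=
    boolP [exists f in E, (z \in f) && [disjoint f & B]]; first by exists f.
  rewrite negb_exists_in => /forall_inP h.
  have := card_sup_meet sE zB (_ : forall e, e \in E -> [set z] \subset e -> ~~ [disjoint e & B]).
  rewrite cards1 => hle; have := hZ z zZ; rewrite ltnNge => /negP[].
  apply: leq_trans (hle _) _; last by rewrite leq_mul2r cB orbT.
  by move=> e /h; rewrite negb_and sub1set => /orP[/negPf->|].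
have [dfM dfZ] : [disjoint f & cover M] /\ [disjoint f & Z :\ z].
  by split; apply: disjointWr fB; rewrite ?subsetUl ?subsetUr.
have [sM' tM' cM'] := matchingU1 fE sM tM dfM.
have [||||M' [h1 h2 h3]] := IH (Z :\ z) (f |: M) _ _ sM' tM'.
- by rewrite cZ ltnS in hk.
- by move=> w /setD1P[_ /hZ].
- have -> : cover (f |: M) = f :|: cover M by rewrite /cover bigcup_setU big_set1.
  rewrite disjoint_sym -setI_eq0; apply/eqP/setP => w; rewrite in_set0.
  apply/negP => /setIP[/setUP[wf|wM] /setD1P[wz wZ]].
    by have := disjointFr dfZ wf; rewrite !inE wz wZ.
  by have := disjointFr dZM wZ; rewrite wM.
- by move: hc; rewrite cM' cZ; clear; lia.
by exists M'; split=> //; rewrite h3 cM' cZ; clear; lia.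
Qed.
End Matching.

(** The summand s + 5 r leaves room for the special vertices, 20 r^3 r gives the growth hypothesis
    of the intersecting case, and the rest makes C(n, r-1) dominate the error terms of
    [heavy_ge]. *)
Definition threshold r s :=
  s + 5 * r + (20 * (r * r * r) + r * r * s * (s + 1) + s * s + 1) * r.

Lemma em_ge n r j : j <= n -> j * 'C(n - j, r) <= em n r.+1 j.
Proof.
move=> jn; rewrite /em; have := bin_drop_ge (n - j) j r; rewrite subnK //; lia.
Qed.

Lemma runiform_rsets (T : finType) r (H : runiform T r) : edges H \subset rsets (verts H) r.
Proof. by apply/subsetP => e /edgesP[eV er]; rewrite inE eV er eqxx. Qed.

(** * Reduction to intersecting families *)

Section Structure.
Variables (r s : nat) (T : finType) (H : runiform T r).
Hypotheses (r4 : 4 <= r) (s1 : 1 <= s).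
Local Notation V := (verts H).
Local Notation n := #|verts H|.
Hypothesis hn : threshold r s <= n.
Hypothesis hnu : nu H <= s.
Hypothesis hE : em n r (s - 1) + hm'' (n - s + 1) r < #|edges H|.

Let sE := runiform_rsets H.

Lemma matching_le (M : {set {set T}}) : M \subset edges H -> trivIset M -> #|M| <= s.
Proof.
by move=> sM tM; apply: leq_trans hnu; apply: leq_bigmax_cond; rewrite sM.
Qed.

Lemma threshold_growth :
  [/\ s <= n, 4 * r <= n - s + 1,
     forall k, k < r -> 20 * (r * r * r) * 'C(n - s + 1, k) <= 'C(n - s + 1, k.+1)
   & (r * r * s * (s + 1) + s * s + 1) * 'C(n, r - 2) <= 'C(n, r - 1)].
Proof.
have h1 : 20 * (r * r * r) * r + (r * r * s * (s + 1) + s * s + 1) * r + 5 * r + s <= n.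
  by apply: leq_trans hn; rewrite /threshold; clear; lia.
split.
- by move: h1; clear; lia.
- by move: h1; clear; lia.
- move=> k kr; apply: bin_grow.
  have : 20 * (r * r * r) * k.+1 <= 20 * (r * r * r) * r by rewrite leq_mul2l kr orbT.
  by move: h1 kr; clear; lia.
- have -> : r - 1 = (r - 2).+1 by lia.
  apply: bin_grow.
  have : (r * r * s * (s + 1) + s * s + 1) * (r - 2).+1 <= (r * r * s * (s + 1) + s * s + 1) * r.
    by rewrite leq_mul2l; apply/orP; right; lia.
  by move: h1; clear; lia.
Qed.

(* Given r * (s + 1) other vertices, a heavy vertex lies in an edge avoiding them. *)
Definition heavy : {set T} := [set z in V |
  r * (s + 1) * 'C(n, r - 2) < #|[set e in edges H | [set z] \subset e]|].
Local Notation Z := heavy.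

Lemma heavy_sub : Z \subset V.
Proof. by apply/subsetP => z; rewrite inE => /andP[]. Qed.

Lemma heavy_matching (Z' : {set T}) (M : {set {set T}}) : Z' \subset Z ->
  M \subset edges H -> trivIset M -> [disjoint Z' & cover M] -> #|M| + #|Z'| <= s.
Proof.
move=> sZ sM tM dM; rewrite leqNgt; apply/negP => hlt.
(* The degree condition in [heavy] only supports matchings of up to s + 1 edges, so Z' is trimmed to
   reach exactly that size. *)
have [Z1 sZ1 cZ1] : exists2 Z1 : {set T}, Z1 \subset Z' & #|M| + #|Z1| = s + 1.
  have hM := matching_le sM tM.
  have [|Z1 h1 h2] := @subset_card T (s + 1 - #|M|) Z'; first by lia.
  by exists Z1; lia.
have [|||M' [h1 h2 h3]] := @extend_matching T V r (edges H) r4 sE (s + 1) Z1 M _ sM tM.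
- by move=> z /(subsetP sZ1)/(subsetP sZ); rewrite inE => /andP[].
- exact: disjointWl sZ1 dM.
- by rewrite cZ1.
by have := matching_le h1 h2; lia.
Qed.

Lemma heavy_le : #|Z| <= s.
Proof.
rewrite -[#|Z|]add0n -(cards0 {set T}).
by apply: heavy_matching; rewrite ?sub0set ?/trivIset /cover ?big_set0 ?cards0 //
   -setI_eq0 setI0.
Qed.

Lemma card_edges_meet (Z' : {set T}) : Z' \subset V ->
  #|[set e in edges H | ~~ [disjoint e & Z']]| <= em n r #|Z'|.
Proof.
move=> sZ'; rewrite -(card_meet r sZ'); apply/subset_leq_card/subsetP => e.
by rewrite !inE => /andP[/edgesP[-> ->] ->]; rewrite eqxx.
Qed.

Lemma card_del (Z' : {set T}) : Z' \subset V -> #|Z'| = s - 1 ->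
  hm'' (n - s + 1) r < #|edges (del H Z')|.
Proof.
move=> sZ' cZ'; have := card_edges_meet sZ'; rewrite cZ' => h.
have := cardsID [set e : {set T} | [disjoint e & Z']] (edges H).
have -> : edges H :&: [set e : {set T} | [disjoint e & Z']] = edges (del H Z').
  by apply/setP => e; rewrite !inE.
have -> : edges H :\: [set e : {set T} | [disjoint e & Z']] =
    [set e in edges H | ~~ [disjoint e & Z']].
  by apply/setP => e; rewrite !inE andbC.
move=> hD; move: hE; rewrite -hD => h2; have := leq_trans h2 (leq_add (leqnn _) h).
by rewrite addnC ltn_add2r.
Qed.

(** Every edge meets the at most r s vertices of a maximum matching. With at most s - 2 heavy
    vertices there are at most (s-2) C(n, r-1) edges through these and r^2 s (s+1) C(n, r-2) others,
    whereas em(n, r, s-1) is at least (s-1) C(n, r-1) - s^2 C(n, r-2). *)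
Lemma heavy_ge : s - 1 <= #|Z|.
Proof.
rewrite leqNgt; apply/negP => hZ.
have [sn _ _ hgr] := threshold_growth.
pose PM := [pred M : {set {set T}} | (M \subset edges H) && trivIset M].
have PM0 : PM set0 by rewrite /= sub0set /trivIset /cover !big_set0 cards0.
pose M := [arg max_(M > set0 | PM M) #|M|].
have [sM tM maxM] : [/\ M \subset edges H, trivIset M & forall M', PM M' -> #|M'| <= #|M|].
  by rewrite /M; case: arg_maxnP => // M' /andP[h1 h2] h3.
have meetM e : e \in edges H -> ~~ [disjoint e & cover M].
  move=> eH; apply/negP => dM; have [h1 h2 h3] := matchingU1 r4 sE eH sM tM dM.
  by have := maxM (e |: M); rewrite /= h1 h2 h3 ltnn => /(_ isT).
have cM : #|cover M| <= r * s.
  apply: leq_trans (card_cover_matching sE sM) _.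
  by rewrite leq_mul2l matching_le ?orbT.
pose D z := [set e in edges H | [set z] \subset e].
have hsum : #|edges H| <= \sum_(z in Z) #|D z| + \sum_(z in cover M :\: Z) #|D z|.
  apply: leq_trans (leq_add (card_bigcup_le _ _) (card_bigcup_le _ _)).
  apply: leq_trans (leq_card_setU _ _).
  apply/subset_leq_card/subsetP => e eH; rewrite in_setU.
  have /pred0Pn[v /andP[/= ve vM]] := meetM e eH.
  have eD : e \in D v by rewrite inE eH sub1set.
  have [vZ|vZ] := boolP (v \in Z).
    by apply/orP; left; apply/bigcupP; exists v.
  by apply/orP; right; apply/bigcupP; exists v => //; rewrite inE vZ.
have h1 : \sum_(z in Z) #|D z| <= (s - 2) * 'C(n, r - 1).
  apply: (@leq_trans (\sum_(z in Z) 'C(n, r - 1))).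
    by apply: leq_sum => z _; have := card_sup [set z] sE; rewrite cards1.
  by rewrite sum_nat_const leq_mul2r; apply/orP; right; move: hZ; clear; lia.
have h2 : \sum_(z in cover M :\: Z) #|D z| <= r * s * (r * (s + 1) * 'C(n, r - 2)).
  apply: (@leq_trans (\sum_(z in cover M :\: Z) r * (s + 1) * 'C(n, r - 2))).
    apply: leq_sum => z /setDP[zM zZ]; rewrite leqNgt; apply: contra zZ => hz.
    rewrite inE hz andbT; move/bigcupP: zM => [e /(subsetP sM)/edgesP[eV _] ze].
    exact: (subsetP eV).
  rewrite sum_nat_const leq_mul2r; apply/orP; right; apply: leq_trans cM.
  exact/subset_leq_card/subsetDl.
have h3 := @em_ge n (r - 1) (s - 1) ltac:(lia).
have h4 := @bin_drop n (s - 1) (r - 2).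
have e1 : (r - 1).+1 = r by move: r4; clear; lia.
have e2 : (r - 2).+1 = r - 1 by move: r4; clear; lia.
rewrite e1 in h3; rewrite e2 in h4.
have h5 : (s - 1) * 'C(n, r - 1) <= (s - 1) * 'C(n - (s - 1), r - 1) +
    (s - 1) * ((s - 1) * 'C(n, r - 2)) by rewrite -mulnDr leq_mul2l h4 orbT.
have h6 : (s - 1) * 'C(n, r - 1) = (s - 2) * 'C(n, r - 1) + 'C(n, r - 1).
  rewrite -[X in _ = _ + X]mul1n -mulnDl; congr (_ * _); move: hZ; clear; lia.
have h7 : (s - 1) * ((s - 1) * 'C(n, r - 2)) <= s * s * 'C(n, r - 2).
  by rewrite mulnA leq_mul2r leq_mul ?leq_subr ?orbT.
have h8 : r * s * (r * (s + 1) * 'C(n, r - 2)) = r * r * s * (s + 1) * 'C(n, r - 2).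
  by rewrite !mulnA; congr (_ * _); rewrite -!mulnA; congr (r * _); rewrite mulnCA.
have c0 : 0 < 'C(n, r - 2).
  by rewrite bin_gt0; move: hn r4; rewrite /threshold; clear; lia.
rewrite h8 in h2; move: hgr; rewrite !mulnDl mul1n.
move: hsum h1 h2 h3 h5 h6 h7 c0 hE.
move: ('C(n, r - 2)) ('C(n, r - 1)) => b a; move: (hm'' _ _) (em _ _ _) => hh ee.
move: (r * r * s * (s + 1) * b) (s * s * b) ((s - 1) * 'C(_, _)) => u v w.
by clear; lia.
Qed.

Lemma erdos_matching_structure : structured s H.
Proof.
have [sn hm grow _] := threshold_growth.
have cZ : forall Z' : {set T}, Z' \subset V -> #|Z'| = s - 1 -> #|verts (del H Z')| = n - s + 1.
  by move=> Z' sZ' cZ'; rewrite /= cardsD (setIidPr sZ') cZ'; move: sn s1; clear; lia.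
have del_edge (Z' : {set T}) : Z' \subset V -> #|Z'| = s - 1 -> exists e, e \in edges (del H Z').
  by move=> h1 h2; apply/card_gt0P; apply: leq_ltn_trans (leq0n _) (card_del h1 h2).
have tau_del (Z' : {set T}) v : Z' \subset V -> #|Z'| = s - 1 ->
    (forall e, e \in edges (del H Z') -> v \in e) -> structured s H.
  move=> sZ' cZ' hv; exists Z'; split=> //; constructor 1.
  have [e eD] := del_edge Z' sZ' cZ'; apply: (tau1 _ eD hv).
  have [eV _] := edgesP eD; exact: subsetP eV _ (hv e eD).
have eqZ : #|Z| = s \/ #|Z| = s - 1 by have := heavy_le; have := heavy_ge; clear; lia.
have E0 e : e \in edges H -> e != set0.
  by move=> /edgesP[_ er]; rewrite -card_gt0 er; move: r4; clear; lia.
case: eqZ => cZs.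
  (* Deleting all heavy vertices but one leaves a star at that vertex: an edge avoiding all s heavy
     vertices would extend to a matching of size s + 1. *)
  have [|Z0 sZ0 cZ0] := @subset_card T (s - 1) Z; first by rewrite cZs leq_subr.
  have [z ez] : exists z, Z :\: Z0 = [set z].
    by apply/cards1P; rewrite cardsD (setIidPr sZ0) cZ0 cZs; apply/eqP; move: s1; clear; lia.
  apply: (tau_del Z0 z) => //; first exact: subset_trans heavy_sub.
  move=> e; rewrite inE => /andP[eH dZ0].
  have [deZ|/pred0Pn[v /andP[/= ve vZ]]] := boolP [disjoint e & Z].
    have := @heavy_matching Z [set e] (subxx _); rewrite sub1set eH cards1 cZs.
    rewrite /cover big_set1 disjoint_sym deZ => /(_ isT) h.
    suff /h/(_ isT) : trivIset [set e] by clear; lia.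
    by rewrite /trivIset /cover !big_set1.
  have : v \in Z :\: Z0 by rewrite inE vZ andbT (disjointFr dZ0 ve).
  by rewrite ez => /set1P <-.
have sZ := heavy_sub.
have cW := cZ _ sZ cZs; have hD := card_del sZ cZs; rewrite -cW in hD hm grow.
set W := verts (del H Z) in cW hD hm grow; set E := edges (del H Z) in hD.
(* Two disjoint edges avoiding Z, together with its s - 1 vertices, would also lead to s + 1
   disjoint edges. *)
have hI : {in E &, forall e f : {set T}, ~~ [disjoint e & f]}.
  move=> e f; rewrite !inE => /andP[eH dZe] /andP[fH dZf]; apply/negP => def.
  have ef : e != f.
    by apply: contraTneq def => <-; rewrite -setI_eq0 setIid E0.
  have := @heavy_matching Z [set e; f] (subxx _); rewrite subUset !sub1set eH fH cards2 ef cZs.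
  have cv : cover [set e; f] = e :|: f by rewrite /cover bigcup_setU !big_set1.
  have tr : trivIset [set e; f].
    apply/trivIsetP => A B /set2P[]-> /set2P[]->; rewrite ?eqxx // => _ //.
    by rewrite disjoint_sym.
  have dd : [disjoint Z & cover [set e; f]].
    rewrite cv disjoint_sym -setI_eq0 setIUl setU_eq0 !setI_eq0 dZe.
    exact: dZf.
  by move=> /(_ isT tr dd); move: s1; clear; lia.
have [/existsP[v /forall_inP hv]|] := boolP [exists v, [forall e in E, v \in e]].
  exact: tau_del sZ cZs hv.
rewrite negb_exists => /forallP hns.
have htau v : exists2 e, e \in E & v \notin e.
  by have := hns v; rewrite negb_forall_in => /exists_inP.
exists Z; split=> //.
have [[x [xs [ys [h1 h2 h3 h4 h5]]]]|[r4e [x [x1 [x2 [h1 h2 h3]]]]]] :=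
    intersecting_structure r4 (runiform_rsets (del H Z)) hI htau hm grow hD.
  constructor 2; exists (size ys); split.
    by case: h4 => h4; [left|right; rewrite h4 -/W cW].
  by exists x, xs, ys; split.
by constructor 3; split=> //; exists x, x1, x2; split.
Qed.
End Structure.

(** * Sharpness *)

Section Intersecting.
Variables (T : finType) (W : {set T}) (r : nat).

Lemma rset_between (A B : {set T}) : A \subset W -> [disjoint A & B] -> #|A| <= r ->
  r + #|B| <= #|W| -> exists f, [/\ f \in rsets W r, A \subset f & [disjoint f & B]].
Proof.
move=> sA dAB cA cB.
have hW : r - #|A| <= #|W :\: (A :|: B)|.
  rewrite cardsD; have := subset_leq_card (subsetIr W (A :|: B)).
  by have := (leq_card_setU A B).1; lia.
have [C sC cC] := subset_card hW; exists (A :|: C).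
have /andP[sCW dC] : (C \subset W) && [disjoint C & A :|: B] by rewrite -subsetD.
have dCA : A :&: C = set0.
  by apply/eqP; rewrite setI_eq0 disjoint_sym; apply: disjointWr dC; apply: subsetUl.
split; last 2 first.
- exact: subsetUl.
- rewrite -setI_eq0 setIUl setU_eq0 !setI_eq0 dAB /=.
  by apply: disjointWr dC; apply: subsetUr.
rewrite inE subUset sA sCW cardsU dCA cards0 cC /=; apply/eqP; lia.
Qed.

(** An edge has either x and one of the x_i or all the y_j, or else all the x_i and one of the y_j.
    Any two of these types meet. *)
Lemma HM_intersecting x xs ys (e f : {set T}) : 0 < size xs ->
  e \in HM W r x xs ys -> f \in HM W r x xs ys -> ~~ [disjoint e & f].
Proof.
move=> sz.
have dich (g : {set T}) : g \in HM W r x xs ys ->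
    (x \in g /\ ((exists2 v, v \in xs & v \in g) \/ [set v in ys] \subset g)) \/
    ({subset xs <= g} /\ exists2 y, y \in ys & y \in g).
  rewrite inE => /andP[_ /or3P[/hasP[v vxs]|/hasP[y yys /eqP->]|/andP[_ h]]].
  - by rewrite subUset !sub1set => /andP[xg vg]; left; split=> //; left; exists v.
  - right; split; first by move=> v vxs; rewrite inE mem_rcons inE vxs orbT.
    by exists y => //; rewrite inE mem_rcons inE eqxx.
  - left; split; first by apply: (subsetP h); rewrite inE mem_head.
    by right; apply: subset_trans h; apply/subsetP => v; rewrite !inE => ->; rewrite orbT.
have wit (g h : {set T}) v : v \in g -> v \in h -> ~~ [disjoint g & h].
  by move=> vg vh; apply/pred0Pn; exists v; rewrite /= vg.
have sym : forall g h : {set T}, ~~ [disjoint g & h] -> ~~ [disjoint h & g].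
  by move=> g h; rewrite disjoint_sym.
have mix (g h : {set T}) :
   (exists2 v, v \in xs & v \in g) \/ [set v in ys] \subset g ->
   {subset xs <= h} /\ (exists2 y, y \in ys & y \in h) -> ~~ [disjoint g & h].
  move=> [[v vxs vg]|/subsetP hg] [hh [y yys yh]]; first exact: wit vg (hh v vxs).
  by apply: wit yh; apply: hg; rewrite inE.
move=> /dich[[xe he]|[he he']] /dich[[xf hf]|[hf hf']].
- exact: wit xe xf.
- exact: mix.
- by apply: sym; apply: mix.
- by case: xs sz he hf {dich mix he' hf'} => // v xs _ he hf; apply: (wit _ _ v);
     [apply: he|apply: hf]; rewrite mem_head.
Qed.

Lemma HM_avoid x xs ys (e : {set T}) : e \in HM W r x xs ys -> x \notin e ->
  {subset xs <= e}.
Proof.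
rewrite inE => /andP[_ /or3P[/hasP[v vxs]|/hasP[y yys /eqP->]|/andP[_ h]]].
- by rewrite subUset !sub1set => /andP[->].
- by move=> _ v vxs; rewrite inE mem_rcons inE vxs orbT.
- by rewrite (subsetP h) // inE mem_head.
Qed.

Lemma HM0_intersecting x x1 x2 (e f : {set T}) :
  e \in HM0 W r x x1 x2 -> f \in HM0 W r x x1 x2 -> ~~ [disjoint e & f].
Proof.
rewrite !inE => /andP[_ he] /andP[_ hf]; apply/negP => def.
set D := [set x; x1; x2] in he hf.
have cD : #|D| <= 3.
  rewrite /D -setUA cardsU1 cardsU1 cards1.
  by case: (_ \notin _); case: (_ \notin _).
have : #|(e :&: D) :|: (f :&: D)| <= #|D|.
  by apply: subset_leq_card; rewrite subUset !subsetIr.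
rewrite cardsU setIACA; move: def; rewrite -setI_eq0 => /eqP->.
by rewrite set0I cards0; lia.
Qed.
End Intersecting.

(** * [HM''] is intersecting and lies in none of the families of the conclusion *)

Section HM''_properties.
Variables (T : finType) (W : {set T}) (r : nat).
Variables (x : T) (xs : seq T) (y1 z1 y2 z2 : T).
Hypothesis r4 : 4 <= r.
Hypothesis szx : size xs = r - 2.
Hypothesis uD : uniq (x :: xs ++ [:: y1; z1; y2; z2]).
Hypothesis sD : {subset x :: xs ++ [:: y1; z1; y2; z2] <= W}.
Hypothesis hW : 5 * r <= #|W|.
Local Notation K := (HM'' W r x xs y1 z1 y2 z2).

Lemma HM''_cases e : e \in K ->
  (x \in e /\ ((exists2 v, v \in xs & v \in e) \/
               ((y1 \in e) || (z1 \in e)) && ((y2 \in e) || (z2 \in e)))) \/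
  ({subset xs <= e} /\ ((y1 \in e) && (z1 \in e) || (y2 \in e) && (z2 \in e))).
Proof.
rewrite inE => /andP[_ /orP[/hasP[v vxs]|]].
  by rewrite subUset !sub1set => /andP[xe ve]; left; split=> //; left; exists v.
rewrite !subUset !sub1set => /or4P[/andP[/andP[-> ->] ->]|/andP[/andP[-> ->] ->]|/andP[/andP[-> ->] ->]|].
- by left; split=> //; right.
- by left; split=> //; right; rewrite orbT.
- by left; split=> //; right; rewrite orbT.
case/or3P => [/andP[/andP[-> ->] ->]|/eqP->|/eqP->].
- by left; split=> //; right; rewrite !orbT.
- right; split; first by move=> v vxs; rewrite inE mem_cat vxs.
  by rewrite !inE !mem_cat !inE !eqxx ?orbT.
- right; split; first by move=> v vxs; rewrite inE mem_cat vxs.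
  by rewrite !inE !mem_cat !inE !eqxx ?orbT.
Qed.

Lemma HM''_intersecting e f : e \in K -> f \in K -> ~~ [disjoint e & f].
Proof.
have wit (g h : {set T}) v : v \in g -> v \in h -> ~~ [disjoint g & h].
  by move=> vg vh; apply/pred0Pn; exists v; rewrite /= vg.
have mix (g h : {set T}) :
   (exists2 v, v \in xs & v \in g) \/
   ((y1 \in g) || (z1 \in g)) && ((y2 \in g) || (z2 \in g)) ->
   {subset xs <= h} -> (y1 \in h) && (z1 \in h) || (y2 \in h) && (z2 \in h) ->
   ~~ [disjoint g & h].
  move=> [[v vxs vg]|/andP[h1 h2]] hh; first by move=> _; apply: wit vg (hh v vxs).
  case/orP => /andP[a b].
    by case/orP: h1 => vg; apply: (wit _ _ _ vg).
  by case/orP: h2 => vg; apply: (wit _ _ _ vg).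
move=> /HM''_cases[[xe he]|[he he']] /HM''_cases[[xf hf]|[hf hf']].
- exact: wit xe xf.
- exact: mix.
- by rewrite disjoint_sym; apply: mix.
- case: xs szx he hf => [|v l] /=; first by move: r4; clear; lia.
  by move=> _ he hf; apply: (wit _ _ v); [apply: he|apply: hf]; rewrite mem_head.
Qed.

Lemma other_leaf v : exists2 u, u \in xs & u != v.
Proof.
have : uniq xs by move: uD; rewrite /= cat_uniq => /and3P[].
case: xs szx => [|a [|b l]] /=; try lia.
move=> _; rewrite inE negb_or => /andP[/andP[ab _] _].
have [av|av] := eqVneq a v; last by exists a; rewrite // mem_head.
by exists b; rewrite ?inE ?eqxx ?orbT // -av eq_sym.
Qed.

Lemma leaf_neqx u : u \in xs -> x != u.
Proof.
by move=> uxs; move: uD; rewrite cons_uniq mem_cat negb_or => /andP[/andP[]];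
   case: eqP => // -> /negP.
Qed.

(** Edges through x and a leaf can be steered clear of any small set; the proofs of non-containment
    rest on this freedom. *)
Lemma HM''_leaf u (B : {set T}) : u \in xs -> x \notin B -> u \notin B -> #|B| <= r ->
  exists f, [/\ f \in K, x \in f, u \in f & [disjoint f & B]].
Proof.
move=> uxs xB uB cB.
have xW : x \in W by apply: sD; rewrite mem_head.
have uW : u \in W by apply: sD; rewrite inE mem_cat uxs orbT.
have [||||f [fr sf fB]] := @rset_between T W r [set x; u] B.
- by rewrite subUset !sub1set xW.
- rewrite -setI_eq0; apply/eqP/setP => w; rewrite !inE.
  by apply/negP => /andP[/orP[]/eqP->]; apply/negP.
- by rewrite cards2; case: (x != u); clear -r4; lia.
- by clear -cB hW r4; lia.
move: sf; rewrite subUset !sub1set => /andP[xf uf].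
by exists f; split=> //; apply: HM''_pair fr xf uxs uf.
Qed.

Lemma HM''_end a b : (a = y1 /\ b = z1) \/ (a = y2 /\ b = z2) ->
  [set v in xs ++ [:: a; b]] \in K.
Proof.
move=> hab; have sab : {subset [:: a; b] <= [:: y1; z1; y2; z2]}.
  by move=> v; rewrite !inE; case: hab => -[-> ->] /orP[]->; rewrite ?orbT.
have u : uniq (xs ++ [:: a; b]).
  move: uD; rewrite cons_uniq !cat_uniq => /and4P[_ -> /hasPn h].
  move=> u4; rewrite andTb; apply/andP; split; first by apply/hasPn => v /sab/h.
  move: u4; case: hab => -[-> ->] u4; apply: subseq_uniq u4.
    by rewrite -[X in subseq _ X]/([:: y1; z1] ++ _) prefix_subseq.
  by rewrite -[X in subseq _ X]/([:: y1; z1] ++ _) suffix_subseq.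
rewrite inE; apply/andP; split.
  rewrite inE card_set_seq // size_cat szx; apply/andP; split; last by apply/eqP => /=; lia.
  apply/subsetP => v; rewrite inE mem_cat => /orP[h|/sab h]; apply: sD;
    by rewrite inE mem_cat h ?orbT.
by case: hab => -[-> ->]; rewrite eqxx ?orbT.
Qed.

Lemma HM''_end_notx a b : (a = y1 /\ b = z1) \/ (a = y2 /\ b = z2) ->
  x \notin [set v in xs ++ [:: a; b]].
Proof.
move=> hab; move: uD; rewrite cons_uniq => /andP[+ _]; rewrite inE; apply: contra.
rewrite !mem_cat => /orP[->//|]; rewrite !inE.
by case: hab => -[-> ->] /orP[]->; rewrite ?orbT.
Qed.

Lemma HM''_no_common v : exists2 e, e \in K & v \notin e.
Proof.
have [->|vx] := eqVneq v x.
  by exists [set w in xs ++ [:: y1; z1]]; [apply: HM''_end|apply: HM''_end_notx]; left.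
have [u uxs uv] := other_leaf v.
have [||| f [fK _ _ df]] := @HM''_leaf u [set v] uxs.
- by rewrite inE eq_sym.
- by rewrite inE.
- by rewrite cards1; clear -r4; lia.
by exists f => //; move: df; rewrite disjoint_sym disjoints1.
Qed.

(** By [HM_avoid] the edges missing x' share the r - 1 elements of [xs']. If x' = x, the two edges
    missing x share only the r - 2 leaves. If not, two edges avoiding x' can be found that share
    only x and one leaf. *)
Lemma HM''_not_HM x' xs' ys' : size xs' = r - 1 -> uniq xs' ->
  ~ K \subset HM W r x' xs' ys'.
Proof.
move=> sz' u' /subsetP sK.
have h e : e \in K -> x' \notin e -> {subset xs' <= e} by move=> /sK; apply: HM_avoid.
have card_le (D : {set T}) : {subset xs' <= D} -> r - 1 <= #|D|.
  move=> sub; rewrite -sz' -card_set_seq // subset_leq_card //.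
  by apply/subsetP => v; rewrite inE => /sub.
have [ex|xx'] := eqVneq x' x.
  have : r - 1 <= #|[set v in xs]|.
    apply: card_le => v vxs'.
    have h1 := h _ (HM''_end (or_introl (conj erefl erefl))).
    have h2 := h _ (HM''_end (or_intror (conj erefl erefl))).
    rewrite ex in h1 h2.
    have := h1 (HM''_end_notx (or_introl (conj erefl erefl))) v vxs'.
    have := h2 (HM''_end_notx (or_intror (conj erefl erefl))) v vxs'.
    rewrite !inE !mem_cat; case: (v \in xs) => //=; rewrite !inE => v2 v1.
    move: uD; rewrite cons_uniq cat_uniq => /and4P[_ _ _].
    by move: v1; case/orP: v2 => /eqP-> /orP[]/eqP->; rewrite /= !inE !eqxx ?orbT ?andbF.
  have uxs : uniq xs by move: uD; rewrite /= cat_uniq => /and3P[].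
  by rewrite card_set_seq // szx; clear -r4; lia.
have [u uxs ux'] := other_leaf x'; have xu := leaf_neqx uxs.
have [||| f [fK xf uf df]] := @HM''_leaf u [set x'] uxs.
- by rewrite inE eq_sym.
- by rewrite inE.
- by rewrite cards1; clear -r4; lia.
have cf : #|f| = r by move: fK; rewrite !inE => /andP[/andP[_ /eqP]].
(* Avoiding [B] makes g miss x' and meet f only in x and u. *)
pose B := x' |: (f :\: [set x; u]).
have [||| g [gK xg ug dg]] := @HM''_leaf u B uxs.
- by rewrite !inE eqxx /= orbF eq_sym.
- by rewrite !inE eqxx orbT /= orbF.
- rewrite cardsU1 cardsD (setIidPr _) ?subUset ?sub1set ?xf //.
  by rewrite cards2 xu cf; case: (_ \notin _); clear -r4; lia.
have x'f : x' \notin f by move: df; rewrite disjoint_sym disjoints1.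
have x'g : x' \notin g.
  by apply/negP => x'g; have := disjointFr dg x'g; rewrite !inE eqxx.
have : r - 1 <= #|[set x; u]|.
  apply: card_le => v vxs'; have vf := h f fK x'f v vxs'; have vg := h g gK x'g v vxs'.
  have := disjointFr dg vg; rewrite in_setU1 in_setD vf andbT.
  by move/negbT; rewrite negb_or negbK => /andP[].
by rewrite cards2 xu; clear -r4; lia.
Qed.

(** An edge through x and a leaf u can avoid the rest of the triple, so the triple contains x and u.
    Two leaves u, v determine it as {x, u, v}, and then some edge through x, y1 and y2 meets it in x
    alone. *)
Lemma HM''_not_HM0 a b c : uniq [:: a; b; c] -> ~ K \subset HM0 W r a b c.
Proof.
move=> u3 /subsetP sK; set D := [set a; b; c].
have cD : #|D| = 3.
  rewrite -[RHS]/(size [:: a; b; c]) -card_set_seq //.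
  by apply: eq_card => i; rewrite !inE orbA.
have h e : e \in K -> 2 <= #|e :&: D| by move=> /sK; rewrite inE => /andP[].
have cDB (A : {set T}) : #|D :\: A| <= r.
  by apply: leq_trans (subset_leq_card (subsetDl _ _)) _; rewrite cD; clear -r4; lia.
have capD (f A : {set T}) : [disjoint f & D :\: A] -> f :&: D \subset A :&: D.
  move=> df; apply/subsetP => v /setIP[vf vD]; rewrite inE vD andbT.
  by have := disjointFr df vf; rewrite inE vD andbT => /negbT; rewrite negbK.
have pairD u : u \in xs -> [set x; u] \subset D.
  move=> uxs; have [||| f [fK xf uf df]] := @HM''_leaf u (D :\: [set x; u]) uxs.
  - by rewrite !inE eqxx.
  - by rewrite !inE eqxx orbT.
  - exact: cDB.
  have le2 := leq_trans (h f fK) (subset_leq_card (capD _ _ df)).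
  apply/setIidPl/eqP; rewrite eqEcard subsetIl /=.
  by apply: leq_trans le2; rewrite cards2; case: (x != u).
have [u uxs _] := other_leaf x; have [v vxs vu] := other_leaf u.
have sxuv : [set x; u; v] \subset D.
  have := pairD u uxs; have := pairD v vxs.
  by rewrite !subUset !sub1set => /andP[-> ->] /andP[_ ->].
have xu := leaf_neqx uxs; have xv := leaf_neqx vxs.
have uxuv : uniq [:: x; u; v] by rewrite /= !inE negb_or xu xv eq_sym vu.
have eD : [set x; u; v] = D.
  apply/eqP; rewrite eqEcard sxuv cD -[3]/(size [:: x; u; v]) -card_set_seq //.
  by apply: subset_leq_card; apply/subsetP => w; rewrite !inE orbA.
have U w : w \in [:: y1; z1; y2; z2] -> (w != x) && (w \notin xs).
  move=> wy; move: uD; rewrite cons_uniq cat_uniq => /and4P[xD _ /hasPn/(_ w wy) wxs _].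
  by rewrite wxs andbT; apply: contraNneq xD => <-; rewrite mem_cat wy orbT.
have /andP[y1x y1xs] := U y1 (mem_head _ _).
have /andP[y2x y2xs] : (y2 != x) && (y2 \notin xs) by apply: U; rewrite !inE eqxx !orbT.
have [||||f [fr sf df]] := @rset_between T W r [set x; y1; y2] (D :\: [set x; y1; y2]).
- by rewrite !subUset !sub1set !sD // !inE ?mem_cat ?inE ?eqxx ?orbT.
- by rewrite -setI_eq0 setIDA (setIC _ D) -setIDA setDv setI0.
- apply: (@leq_trans 3); last by clear -r4; lia.
  rewrite -setUA cardsU1 cardsU1 cards1.
  by case: (_ \notin _); case: (_ \notin _).
- by have := cDB [set x; y1; y2]; move: hW; clear; lia.
have fK : f \in K.
  move: sf; rewrite !subUset !sub1set => /andP[/andP[h1 h2] h3].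
  by apply: HM''_trans; rewrite ?h1 ?h2 ?h3.
have := leq_trans (h f fK) (subset_leq_card (capD _ _ df)).
have -> : [set x; y1; y2] :&: D = [set x].
  rewrite -eD; apply/setP => w; rewrite !inE.
  have [->|wx] := eqVneq w x; first by [].
  apply/negP => /andP[/orP[]/eqP-> /orP[]/eqP e].
  - by move: y1xs; rewrite e uxs.
  - by move: y1xs; rewrite e vxs.
  - by move: y2xs; rewrite e uxs.
  - by move: y2xs; rewrite e vxs.
by rewrite cards1.
Qed.
End HM''_properties.

(** All three outcomes are intersecting, which is what rules out every deleted set other than Z in
    the sharpness proof. *)
Lemma structured_intersecting (T : finType) r s (H : runiform T r) (Z : {set T}) :
  4 <= r -> 1 < #|verts (del H Z)| ->
  [\/ tau (del H Z) = 1,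
      exists t : nat, (1 <= t <= r - 1 \/ t = #|verts H| - s + 1 - r) /\ sub_HM (del H Z) t
    | r = 4 /\ sub_HM0 (del H Z)] ->
  {in edges (del H Z) &, forall e f : {set T}, ~~ [disjoint e & f]}.
Proof.
move=> r4 hV [ht|[t [_ [x [xs [ys [szx _ _ _ sH]]]]]]|[_ [x [x1 [x2 [_ _ sH]]]]]] e f eE fE.
- have [v hv] := tau1_common hV ht.
  by apply/pred0Pn; exists v; rewrite /= [v \in e]hv ?[v \in f]hv.
- by apply: HM_intersecting (subsetP sH e eE) (subsetP sH f fE); rewrite szx; lia.
- exact: HM0_intersecting (subsetP sH e eE) (subsetP sH f fE).
Qed.

(** * The extremal family *)

Section Sharp.
Variables (T : finType) (V : {set T}) (r s : nat).
Hypotheses (r4 : 4 <= r) (s1 : 1 <= s) (hV : s + 6 * r <= #|V|).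
Variables (Z : {set T}) (x : T) (xs : seq T) (y1 z1 y2 z2 : T).
Hypotheses (ZV : Z \subset V) (cZ : #|Z| = s - 1).
Local Notation W := (V :\: Z).
Hypothesis szx : size xs = r - 2.
Hypothesis uD : uniq (x :: xs ++ [:: y1; z1; y2; z2]).
Hypothesis sD : {subset x :: xs ++ [:: y1; z1; y2; z2] <= W}.
Local Notation K := (HM'' W r x xs y1 z1 y2 z2).

Definition sharp_edges : {set {set T}} :=
  [set e in rsets V r | ~~ [disjoint e & Z]] :|: K.

Lemma HM''_rsets e : e \in K -> e \subset V /\ [disjoint e & Z].
Proof. by rewrite inE => /andP[+ _]; rewrite inE subsetD => /andP[/andP[]]. Qed.

Lemma sharp_subproof : {in sharp_edges, forall e : {set T}, e \subset V /\ #|e| = r}.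
Proof.
move=> e /setUP[|eK]; first by rewrite inE => /andP[+ _]; rewrite inE => /andP[? /eqP].
have [eV _] := HM''_rsets eK; split=> //.
by move: eK; rewrite inE => /andP[+ _]; rewrite inE => /andP[_ /eqP].
Qed.

Definition sharp : runiform T r := RUniform sharp_subproof.

Lemma cardW : #|W| = #|V| - s + 1.
Proof. by rewrite cardsD (setIidPr ZV) cZ; move: hV r4 s1; clear; lia. Qed.

Lemma W_large : 5 * r <= #|W|.
Proof. by rewrite cardW; move: hV r4 s1; clear; lia. Qed.

Lemma card_sharp : #|edges sharp| = em #|V| r (s - 1) + hm'' (#|V| - s + 1) r.
Proof.
rewrite -cardW -(card_HM'' _ szx uD sD); last by move: r4; clear; lia.
rewrite -cZ -(card_meet r ZV) /= cardsU.
have -> : [set e in rsets V r | ~~ [disjoint e & Z]] :&: K = set0.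
  apply/setP => e; rewrite in_setI in_set0; apply/negP => /andP[h /HM''_rsets[_ dZ]].
  by move: h; rewrite inE dZ andbF.
by rewrite cards0 subn0.
Qed.

(** A matching has at most one edge in the intersecting family [HM''], and its other edges contain
    distinct vertices of Z. *)
Lemma sharp_nu : nu sharp <= s.
Proof.
apply/bigmax_leqP => M /andP[sM /trivIsetP tM].
have c2 : #|M :&: K| <= 1.
  rewrite leqNgt; apply/negP => /card_gt1P[e [f [/setIP[eM eK] /setIP[fM fK] ef]]].
  by have := HM''_intersecting r4 szx eK fK; rewrite tM.
(* The default x is never taken on the edges outside [K], which meet Z. *)
pose g (e : {set T}) := odflt x [pick v in e :&: Z].
have gP e : e \in M :\: K -> g e \in e :&: Z.
  move=> /setDP[eM eK]; have /setUP[|eK'] := subsetP sM e eM; last by rewrite eK' in eK.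
  rewrite inE => /andP[_ /pred0Pn[v ve]]; rewrite /g; case: pickP => //= h.
  by move: (h v); rewrite inE [_ && _]ve.
have c1 : #|M :\: K| <= #|Z|.
  rewrite -(@card_in_imset _ _ g).
    by apply/subset_leq_card/subsetP => _ /imsetP[e /gP/setIP[_ ?] ->].
  move=> e f eM fM gef; apply/eqP/negPn/negP => ef.
  have := tM e f; have /setDP[-> _] := eM; have /setDP[-> _] := fM => /(_ isT isT ef).
  have /setIP[ge _] := gP e eM; have /setIP[gf _] := gP f fM.
  by move=> d; have := disjointFr d ge; rewrite gef gf.
by rewrite -(cardsID K M); move: (leq_add c2 c1); rewrite cZ => h; apply: leq_trans h _;
   move: s1; clear; lia.
Qed.

Lemma sharp_not_structured : ~ structured s sharp.
Proof.
case=> Z' [sZ' cZ' hst]; rewrite /= in sZ'.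
have hW := W_large.
have hV1 : 1 < #|verts (del sharp Z')|.
  by rewrite /= cardsD (setIidPr sZ') cZ'; move: hV r4 s1; clear; lia.
have hI := structured_intersecting r4 hV1 hst.
have [eZ|neZ] := eqVneq Z' Z.
  rewrite {}eZ in hst hI hV1 cZ' sZ'.
  have eE : edges (del sharp Z) = K.
    apply/setP => e; rewrite [LHS]inE /=; apply/andP/idP.
      by case=> /setUP[|//]; rewrite inE => /andP[_ /negP].
    by move=> eK; split; [apply/setUP; right|have [] := HM''_rsets eK].
  case: hst => [ht|[t [_ [x' [xs' [ys' [szx' _ u' _ sH]]]]]]|[_ [a [b [c [u3 _ sH]]]]]].
  - have [v hv] := tau1_common hV1 ht.
    have [e eK] := HM''_no_common r4 szx uD sD hW v.
    by rewrite hv // eE.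
  - rewrite eE in sH; apply: (HM''_not_HM r4 szx uD sD hW szx' _ sH).
    by move: u'; rewrite cons_uniq cat_uniq => /and4P[].
  - by rewrite eE in sH; apply: (HM''_not_HM0 r4 szx uD sD hW u3 sH).
have cZZ : #|Z'| = #|Z| by rewrite cZ cZ'.
(* With Z' different from Z some z in Z survives. It then suffices to find an edge e missing z,
   since an r-set through z avoiding Z' and e is an edge disjoint from e. *)
have [z zZ zZ'] : exists2 z, z \in Z & z \notin Z'.
  have : ~~ (Z \subset Z').
    by apply: contra neZ => sZZ; rewrite eq_sym eqEcard sZZ cZZ leqnn.
  by case/subsetPn => z; exists z.
have star e v : e \in rsets V r -> v \in Z -> v \in e -> [disjoint e & Z'] ->
    e \in edges (del sharp Z').
  move=> er vZ ve dZ'; rewrite inE dZ' andbT; apply/setUP; left; rewrite inE er.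
  by apply/pred0Pn; exists v; rewrite /= ve.
have zV := subsetP ZV z zZ.
have [e eE ze] : exists2 e, e \in edges (del sharp Z') & z \notin e.
  have [/existsP[w /and3P[wZ wZ' wz]]|] := boolP [exists w, [&& w \in Z, w \notin Z' & w != z]].
    have [||||f [fr sf df]] := @rset_between T V r [set w] (z |: Z').
    - by rewrite sub1set (subsetP ZV).
    - by rewrite disjoints1 !inE negb_or wz.
    - by rewrite cards1; move: r4; clear; lia.
    - by rewrite cardsU1 cZ' zZ'; move: hV s1; clear; lia.
    exists f; last by apply/negP => zf; have := disjointFr df zf; rewrite !inE eqxx.
    by apply: (star f w) => //; [rewrite sub1set in sf|apply: disjointWr df; apply: subsetUr].
  rewrite negb_exists => /forallP hz.
  have ZD : Z :\: Z' = [set z].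
    apply/setP => w; rewrite !inE; have := hz w.
    case: eqVneq => [->|wz]; first by rewrite zZ zZ'.
    by rewrite andbT negb_and negbK orbC; case: (w \in Z'); case: (w \in Z).
  (* If z is the only survivor, Z' has just one vertex w outside Z, and an edge of [HM''] missing w
     serves as e. *)
  have /eqP/cards1P[w Z'D] : #|Z' :\: Z| = 1.
    have := cardsID Z Z'; have := cardsID Z' Z; rewrite ZD cards1 setIC cZZ.
    by clear; lia.
  have [e eK we] := HM''_no_common r4 szx uD sD hW w; have [eV dZ] := HM''_rsets eK.
  exists e; last by apply/negP => ze; have := disjointFr dZ ze; rewrite zZ.
  rewrite inE; apply/andP; split; first by apply/setUP; right.
  rewrite -setI_eq0; apply/eqP/setP => v; rewrite in_set0; apply/negP => /setIP[ve vZ'].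
  have : v \in Z' :\: Z by rewrite inE vZ' andbT (disjointFr dZ ve).
  by rewrite Z'D => /set1P vw; rewrite -vw ve in we.
have [eV er] := edgesP eE.
have [||||f [fr sf df]] := @rset_between T V r [set z] (Z' :|: e).
- by rewrite sub1set.
- by rewrite disjoints1 inE negb_or zZ'.
- by rewrite cards1; move: r4; clear; lia.
- have := (leq_card_setU Z' e).1; rewrite er cZ'; move: hV s1 r4.
  by move: #|Z' :|: e|; clear; lia.
have fE : f \in edges (del sharp Z').
  by apply: (star f z) => //; [rewrite sub1set in sf|apply: disjointWr df; apply: subsetUl].
by have := hI e f eE fE; rewrite disjoint_sym (disjointWr _ df) ?subsetUr.
Qed.
End Sharp.

Theorem theorem9 (r s : nat) (hr : 4 <= r) (hs : 1 <= s) :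
  exists n0 : nat, forall n : nat, n0 <= n ->
    (forall (T : finType) (H : runiform T r),
        #|verts H| = n -> nu H <= s ->
        em n r (s - 1) + hm'' (n - s + 1) r < #|edges H| ->
        structured s H) /\
    (exists (T : finType) (H : runiform T r),
        [/\ #|verts H| = n, nu H <= s,
            #|edges H| = em n r (s - 1) + hm'' (n - s + 1) r
          & ~ structured s H]).
Proof.
exists (threshold r s) => n hn; split.
  by move=> T H cV hnu hE; apply: erdos_matching_structure; rewrite ?cV.
(* The product in [threshold] is at least r, which raises its 5 r to 6 r. *)
have hV : s + 6 * r <= #|[set: 'I_n]|.
  rewrite cardsT card_ord; apply: leq_trans hn; rewrite /threshold.
  have : r <= (20 * (r * r * r) + r * r * s * (s + 1) + s * s + 1) * r by rewrite leq_pmull // addn1.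
  by clear; lia.
have [|Z ZV cZ] := @subset_card 'I_n (s - 1) [set: 'I_n]; first by move: hV; clear; lia.
have [|t [szt ut tW]] := @fresh 'I_n ([set: 'I_n] :\: Z) [::] (r + 3) _ isT.
  rewrite (cardW hr hs hV ZV cZ); move: hV; rewrite cardsT card_ord [size _]/=.
  by move: hs hr; clear; lia.
case: t szt ut tW => [|x t] /= szt ut tW; first by move: szt; clear; lia.
have st : size t = r + 2 by apply/eqP; rewrite -eqSS szt addnS.
have szl : size (take (r - 2) t) = r - 2.
  by rewrite size_takel // st; move: hr; clear; lia.
have : size (drop (r - 2) t) = 4 by rewrite size_drop st; move: hr; clear; lia.
case ed : (drop (r - 2) t) => [|y1 [|z1 [|y2 [|z2 []]]]] //= _.
have et : t = take (r - 2) t ++ [:: y1; z1; y2; z2] by rewrite -ed cat_take_drop.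
exists 'I_n, (@sharp 'I_n setT r Z x (take (r - 2) t) y1 z1 y2 z2).
rewrite et in ut tW; split.
- by rewrite /= cardsT card_ord.
- exact: sharp_nu.
- by rewrite (card_sharp hr hs) // cardsT card_ord.
- exact: sharp_not_structured.
Qed.
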